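(* Let $r>0$, and let $\mathcal{L}$ be a layout with obstacles $1,\dots,b$ ($b\ge1$), where $\delta_i$ denotes the inradius of the convex hull (IRCH) of the $i$-th obstacle. Suppose $\delta_{\min}=\min(\delta_1,\delta_2,\dots,\delta_b)\le\frac{\sqrt3}{6}r$, and let $x^*$ be the smallest real positive root of the cubic equation $f(x)=0$, where $f(x)=x^3-rx^2+\delta_{\min}^2x+\delta_{\min}^2r$. Let $p$ be a triangle in a hyper-triangulation $\mathcal{HT}(R,\mathcal{L})$ with $R\le 2x^*$. Then any point $X$ within the visibility area of $p$ also lies within the visibility area of any point inside $p$; that is, $$X\in\mathcal{V}_r(p)\ \Longrightarrow\ X\in\mathcal{V}_r(Q)\quad\text{for all } Q\in p.$$
   Context: Layout: a layout $\mathcal{L}$ is a planar region bounded by a polygon (the walls), from which finitely many polygonal obstacles are removed; boundary points of walls and obstacles count as points of the layout. Visibility area of a point: for a point $P$ in $\mathcal{L}$ and $r>0$, $\mathcal{V}_r(P)$ is the set of all points $Y$ such that the segment $PY$ lies entirely inside the layout (no layout edge or obstacle blocks it) and $\|PY\|\le r$. Visibility area of a polygon: for a polygon $p$ with vertices $P_1,\dots,P_l$, $\mathcal{V}_r(p)=\bigcap_{i=1}^{l}\mathcal{V}_r(P_i)$. Hyper-triangulation $\mathcal{HT}(R,\mathcal{L})$: start with a triangulation of $\mathcal{L}$ (a partition into triangles by non-crossing diagonals between vertices of walls and obstacles), and repeatedly divide triangles by connecting the midpoint of the largest side of a triangle to its opposite vertex, until no triangle has a side longer than $R$. Inradius of the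 convex hull (IRCH) of an obstacle: the radius of the largest disc contained in the convex hull of the obstacle. *)

(* Defs.v *)
From mathcomp Require Import all_boot all_order all_algebra.
From mathcomp Require Import all_classical all_reals all_analysis.

Set Implicit Arguments.
Unset Strict Implicit.
Unset Printing Implicit Defensive.

Import Order.TTheory GRing.Theory Num.Theory.
Import numFieldNormedType.Exports.

Local Open Scope classical_set_scope.
Local Open Scope ring_scope.

Notation plane R := 'rV[R]_2.

Section Geometry.
Context {R : realType}.
Implicit Types (a b c x y : plane R) (A : set (plane R)) (d rho : R).

(* The library norm on row vectors is the sup norm (it induces the same
   topology), hence an explicit Euclidean distance. *)
Definition dist x y : R := Num.sqrt (\sum_(k < 2) (x 0 k - y 0 k) ^+ 2).

Definition disc c rho : set (plane R) := [set x | dist c x <= rho].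

Definition between a b (t : R) : plane R := (1 - t) *: a + t *: b.

Definition segment a b : set (plane R) :=
  [set between a b t | t in [set t | 0 <= t <= 1]].

Definition open_segment a b : set (plane R) :=
  [set between a b t | t in [set t | 0 < t < 1]].

Definition convex_hull A : set (plane R) := smallest (@convex_set R (plane R)) A.

Definition collinear a b c : Prop :=
  (b 0 0 - a 0 0) * (c 0 1 - a 0 1) = (b 0 1 - a 0 1) * (c 0 0 - a 0 0).

Definition least (S : set R) (m : R) : Prop := S m /\ lbound S m.

End Geometry.

(* A polygon is given by its cyclic list of vertices; [polygon_simple] says
   that the closed polygonal chain, travelled once, is injective. *)
Record polygon (R : realType) := Polygon {
  polygon_size : nat;
  vertex : 'I_polygon_size -> plane R;
  polygon_size_ge3 : (3 <= polygon_size)%N;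
  polygon_simple : forall (i j : 'I_polygon_size) (s t : R),
    0 <= s < 1 -> 0 <= t < 1 ->
    between (vertex i) (vertex (ordS i)) s =
      between (vertex j) (vertex (ordS j)) t ->
    i = j /\ s = t }.

Section Polygon.
Context {R : realType}.
Implicit Type P : polygon R.

Definition polygon_boundary P : set (plane R) :=
  \bigcup_i segment (vertex (p := P) i) (vertex (ordS i)).

(* The open region enclosed by the chain: by the Jordan curve theorem, the
   bounded connected component of its complement. *)
Definition polygon_inside P : set (plane R) :=
  [set x | ~ polygon_boundary P x /\
           bounded_set (connected_component (~` polygon_boundary P) x)].

Definition polygon_region P : set (plane R) :=
  polygon_inside P `|` polygon_boundary P.

Definition polygon_vertices P : set (plane R) := range (vertex (p := P)).

(* Inradius of the convex hull; the supremum is attained by compactness. *)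
Definition irch P : R :=
  sup [set rho | 0 <= rho /\
         exists c, disc c rho `<=` convex_hull (polygon_region P)].

End Polygon.

Record layout (R : realType) (b : nat) := Layout {
  walls : polygon R;
  obstacle : 'I_b -> polygon R }.

Section Layout.
Context {R : realType} {b : nat}.
Implicit Type L : layout R b.

(* Only the open obstacles are removed: boundary points of walls and obstacles
   belong to the layout. *)
Definition layout_set L : set (plane R) :=
  polygon_region (walls L) `\` \bigcup_i polygon_inside (obstacle L i).

Definition layout_vertices L : set (plane R) :=
  polygon_vertices (walls L) `|` \bigcup_i polygon_vertices (obstacle L i).

Definition visibility (r : R) L (x : plane R) : set (plane R) :=
  [set y | segment x y `<=` layout_set L /\ dist x y <= r].

End Layout.

Definition triangle (R : realType) := 'I_3 -> plane R.

Section Triangle.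
Context {R : realType}.
Implicit Types (t : triangle R) (i j : 'I_3).

Definition triangle_set t : set (plane R) := convex_hull (range t).

(* Side [i] is the one opposite to the corner [t i]. *)
Definition side_length t i : R := dist (t (ordS i)) (t (ord_pred i)).

Definition open_side t i : set (plane R) :=
  open_segment (t (ordS i)) (t (ord_pred i)).

Definition longest_side t i : Prop :=
  forall j, side_length t j <= side_length t i.

Definition replace_corner t j (m : plane R) : triangle R :=
  fun k => if k == j then m else t k.

Definition halves t i : set (triangle R) :=
  let m := between (t (ordS i)) (t (ord_pred i)) 2^-1 in
  [set replace_corner t (ordS i) m; replace_corner t (ord_pred i) m].

Definition no_side_longer (ell : R) (T : set (triangle R)) : Prop :=
  forall t i, T t -> side_length t i <= ell.

End Triangle.

Section HyperTriangulation.
Context {R : realType} {b : nat}.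
Implicit Types (L : layout R b) (T : set (triangle R)).

Record triangulation L T : Prop := Triangulation {
  triangulation_finite : finite_set T;
  triangulation_nondegenerate : forall t, T t ->
    ~ collinear (t 0) (t 1) (t 2%:R);
  triangulation_vertices : forall t i, T t -> layout_vertices L (t i);
  triangulation_noncrossing : forall t t' i j, T t -> T t' ->
    open_side t i = open_side t' j \/
    open_side t i `&` open_side t' j = set0;
  triangulation_disjoint : trivIset T (fun t => interior (triangle_set t));
  triangulation_cover : \bigcup_(t in T) triangle_set t = layout_set L }.

(* States of the subdivision process: it goes on only while some side is
   longer than [ell]; which triangle is divided next, and which side is used
   in case of a tie, are left free. *)
Inductive subdivision (ell : R) L : set (triangle R) -> Prop :=
| subdivision_start T : triangulation L T -> subdivision ell L T
| subdivision_step T t i :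
    subdivision ell L T -> ~ no_side_longer ell T -> T t -> longest_side t i ->
    subdivision ell L ((T `\ t) `|` halves t i).

Definition hyper_triangulation (ell : R) L T : Prop :=
  subdivision ell L T /\ no_side_longer ell T.

Definition triangle_visibility (r : R) L (t : triangle R) : set (plane R) :=
  \bigcap_i visibility r L (t i).

End HyperTriangulation.

Definition critical_cubic {R : realType} (r d : R) : {poly R} :=
  'X^3 - r *: 'X^2 + d ^+ 2 *: 'X + (d ^+ 2 * r)%:P.

(* Main.v *)
(* Suppose that Z lies on the segment XQ but not in the layout. By
   Caratheodory's theorem Z lies in a triangle X A B, with A and B corners of p,
   whose three sides run inside the layout. Hence the component containing Z of
   the complement of the blocking polygonal curve cannot leave X A B. If the
   curve is the walls, that component is unbounded, which is absurd. If it is an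
   obstacle, the whole curve lies in the closure of the component, so the
   obstacle lies in X A B and its IRCH is at most the inradius of X A B. As
   |XA|, |XB| <= r and |AB| <= 2 xs, that inradius is at most dmin, with equality
   only if |XA| = |XB| = r and |AB| = 2 xs (the cubic says that the inradius of
   this isosceles triangle is dmin). The equality case is possible for a single
   triangle X A B, e.g. when the obstacle is that triangle; it is excluded by
   looking at the third corner of p, which must be seen from X as well: it cuts
   off from X A B a smaller triangle of the same kind that still contains Z. *)

Require Import Defs.
From mathcomp Require Import all_boot all_order all_algebra.
From mathcomp Require Import all_classical all_reals all_analysis.
From mathcomp Require Import ring lra.

Set Implicit Arguments.
Unset Strict Implicit.
Unset Printing Implicit Defensive.

Import Order.TTheory GRing.Theory Num.Theory.
Import numFieldNormedType.Exports.

Local Open Scope classical_set_scope.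
Local Open Scope ring_scope.

(** * Convex subsets of the plane *)

Section Convexity.
Context {R : realType}.
Implicit Types (a b c u v w x y z : plane R) (A S : set (plane R)).

Definition det2 u v : R := u 0 0 * v 0 1 - u 0 1 * v 0 0.

Lemma plane_eq x y : x 0 0 = y 0 0 -> x 0 1 = y 0 1 -> x = y.
Proof.
move=> h0 h1; apply/rowP => i; case: (unliftP ord0 i) => [j ->|->] //.
by rewrite (_ : lift _ _ = 1) //; apply/val_inj; rewrite /= ord1.
Qed.

Lemma ord2P (i : 'I_2) : i = 0 \/ i = 1.
Proof. by case: i => -[|[|//]] h; [left|right]; exact: val_inj. Qed.

Definition segconv S := forall x y, S x -> S y -> segment x y `<=` S.

Lemma convex_setE S : @convex_set R (plane R) S <-> segconv S.
Proof.
split=> [cS x y Sx Sy _ [t /= /andP[t0 t1] <-]|cS x y l].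
  have := @cS y x (@Itv01 R t t0 t1).
  by rewrite !inE => /(_ Sy Sx); rewrite /conv /= addrC.
rewrite !inE => Sx Sy; apply: (cS _ _ Sy Sx).
exists l%:num; first by rewrite /= ge0 le1.
by rewrite /between addrC.
Qed.

Lemma hull_min A S : segconv S -> A `<=` S -> convex_hull A `<=` S.
Proof. by move=> cS AS x; apply; split => //; apply/convex_setE. Qed.

Lemma sub_hull A : A `<=` convex_hull A.
Proof. by move=> x Ax B [_]; apply. Qed.

Lemma hull_segconv A : segconv (convex_hull A).
Proof.
move=> x y hx hy z hz B [cB AB]; have /convex_setE cB' := cB.
by apply: cB' hz; [apply: hx|apply: hy].
Qed.

Lemma betweenE x y t k : between x y t 0 k = (1 - t) * x 0 k + t * y 0 k.
Proof. by rewrite /between !mxE. Qed.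

Lemma between0 x y : between x y 0 = x.
Proof. by rewrite /between subr0 scale1r scale0r addr0. Qed.

Lemma between1 x y : between x y 1 = y.
Proof. by rewrite /between subrr scale0r scale1r add0r. Qed.

Lemma betweenC x y t : between x y t = between y x (1 - t).
Proof. by rewrite /between subKr addrC. Qed.

Lemma segmentL x y : segment x y x.
Proof. by exists 0; rewrite ?between0 //= lexx ler01. Qed.

Lemma segmentR x y : segment x y y.
Proof. by exists 1; rewrite ?between1 //= lexx ler01. Qed.

Lemma segmentC x y : segment x y = segment y x.
Proof.
by apply/seteqP; split=> _ [t /= ht <-]; rewrite betweenC; exists (1 - t) => //=;
  move: ht => /andP[? ?]; apply/andP; split; lra.
Qed.

Lemma segment_segconv a b : segconv (segment a b).
Proof.
move=> _ _ [s /= /andP[s0 s1] <-] [t /= /andP[t0 t1] <-] _ [q /= /andP[q0 q1] <-].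
exists ((1 - q) * s + q * t); first by apply/andP; split; nra.
by apply: plane_eq; rewrite !betweenE; ring.
Qed.

Lemma det2_between u a x y t :
  det2 u (between x y t - a) = (1 - t) * det2 u (x - a) + t * det2 u (y - a).
Proof. by rewrite /det2 !mxE; ring. Qed.

Lemma ord3P (i : 'I_3) : [\/ i = 0, i = 1 | i = 2%:R].
Proof.
by case: i => -[|[|[|//]]] h; [apply: Or31|apply: Or32|apply: Or33]; exact: val_inj.
Qed.

Lemma convex_comb_gt0 (t p q : R) : 0 <= t -> t <= 1 -> 0 < p -> 0 < q ->
  0 < (1 - t) * p + t * q.
Proof.
move=> t0 t1 p0 q0; have [->|tn0] := eqVneq t 0; first by lra.
have : 0 < t by rewrite lt_neqAle eq_sym tn0.
nra.
Qed.

Lemma halfplane_segconv u a : segconv [set x | 0 <= det2 u (x - a)].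
Proof.
move=> x y /= hx hy _ [t /= /andP[t0 t1] <-]; rewrite det2_between; nra.
Qed.

Lemma open_halfplane_segconv u a : segconv [set x | det2 u (x - a) < 0].
Proof.
move=> x y /= hx hy _ [t /= /andP[t0 t1] <-]; rewrite det2_between.
have := @convex_comb_gt0 t (- det2 u (x - a)) (- det2 u (y - a)) t0 t1.
by rewrite !oppr_gt0 !mulrN -opprD oppr_gt0; apply.
Qed.

Definition tri a b c : set (plane R) := [set x | exists s t q : R,
  [/\ 0 <= s, 0 <= t, 0 <= q, s + t + q = 1 & x = s *: a + t *: b + q *: c]].

Lemma tri_segconv a b c : segconv (tri a b c).
Proof.
move=> _ _ [s [t [q [s0 t0 q0 h ->]]]] [s' [t' [q' [s0' t0' q0' h' ->]]]] _
  [l /= /andP[l0 l1] <-].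
exists ((1 - l) * s + l * s'), ((1 - l) * t + l * t'), ((1 - l) * q + l * q').
split; [nra|nra|nra|nra|].
by apply: plane_eq; rewrite betweenE !mxE; ring.
Qed.

Lemma tri_min a b c S : segconv S -> S a -> S b -> S c -> tri a b c `<=` S.
Proof.
move=> cS Sa Sb Sc _ [s [t [q [s0 t0 q0 h ->]]]].
(* The combination is reached in two moves, first along [a b] and then towards [c]; the first
   parameter is [t / (1 - q)], so [q = 1] is treated apart. *)
have [q1|q1] := eqVneq q 1.
  have [-> ->] : s = 0 /\ t = 0 by split; lra.
  by rewrite q1 !scale0r !add0r scale1r.
have q1' : 0 < 1 - q.
  by rewrite subr_gt0 lt_neqAle q1 /=; lra.
pose d := between a b (t / (1 - q)).
have t1 : t / (1 - q) <= 1 by rewrite ler_pdivrMr //; lra.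
have Sd : S d.
  by apply: (cS _ _ Sa Sb); exists (t / (1 - q)) => //=; rewrite t1 andbT divr_ge0 // ltW.
apply: (cS _ _ Sd Sc); exists q; first by apply/andP; split; lra.
have hs : s = 1 - q - t by lra.
by apply: plane_eq; rewrite betweenE /d !betweenE !mxE hs; field; lra.
Qed.

Lemma tri1 a b c : tri a b c a.
Proof. by exists 1, 0, 0; split; rewrite ?ler01 ?addr0 ?scale0r ?scale1r ?addr0. Qed.

Lemma tri2 a b c : tri a b c b.
Proof. by exists 0, 1, 0; split; rewrite ?ler01 ?addr0 ?add0r ?scale0r ?scale1r ?addr0 ?add0r. Qed.

Lemma tri3 a b c : tri a b c c.
Proof. by exists 0, 0, 1; split; rewrite ?ler01 ?addr0 ?add0r ?scale0r ?scale1r ?addr0 ?add0r. Qed.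

Lemma triangle_setE (t : triangle R) : triangle_set t = tri (t 0) (t 1) (t 2%:R).
Proof.
apply/seteqP; split.
  apply: hull_min; first exact: tri_segconv.
  move=> _ [i _ <-]; case: (ord3P i) => ->; [exact: tri1|exact: tri2|exact: tri3].
by apply: tri_min; [exact: hull_segconv|apply: sub_hull; eexists..].
Qed.

End Convexity.

(** * Connected components of complements *)

Section Topology.
Context {R : realType}.
Implicit Types (a b c u v w x y z : plane R) (A S G : set (plane R)).

Lemma plane_ballP x e y : ball x e y <-> 0 < e /\ forall k, `|x 0 k - y 0 k| < e.
Proof.
split=> [[e0 h]|[e0 h]]; split=> //; first by move=> k; exact: (h 0 k).
by move=> i k; rewrite (ord1 i); exact: h.
Qed.

Lemma ball_segconv x e : segconv (ball x e).
Proof.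
move=> y z /plane_ballP[e0 hy] /plane_ballP[_ hz] _ [t /= /andP[t0 t1] <-].
apply/plane_ballP; split=> // k; rewrite betweenE.
move: (hy k) (hz k); rewrite !ltr_norml => /andP[h1 h2] /andP[h3 h4].
have p1 : 0 < e + (x 0 k - y 0 k) by lra.
have p2 : 0 < e + (x 0 k - z 0 k) by lra.
have q1 : 0 < e - (x 0 k - y 0 k) by lra.
have q2 : 0 < e - (x 0 k - z 0 k) by lra.
have := convex_comb_gt0 t0 t1 p1 p2; have := convex_comb_gt0 t0 t1 q1 q2.
by move=> ? ?; apply/andP; split; lra.
Qed.

Lemma continuous_between x y : continuous (between x y).
Proof.
move=> t; apply: cvgD; apply: cvgZ; try exact: cvg_cst; last exact: cvg_id.
by apply: cvgB; [exact: cvg_cst|exact: cvg_id].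
Qed.

Lemma segment_itv x y : segment x y = between x y @` `[0, 1].
Proof. by apply/seteqP; split=> _ [t /= ht <-]; exists t => //=; move: ht; rewrite in_itv. Qed.

Lemma plane_segment_connected x y : connected (segment x y).
Proof.
rewrite segment_itv; apply: connected_continuous_connected; first exact: segment_connected.
exact/continuous_subspaceT/continuous_between.
Qed.

Lemma segment_closed x y : closed (segment x y).
Proof.
apply: compact_closed; first exact: norm_hausdorff.
rewrite segment_itv; apply: continuous_compact; last exact: segment_compact.
exact/continuous_subspaceT/continuous_between.
Qed.

Lemma segconv_connected S : segconv S -> connected S.
Proof.
move=> cS; have [->|/set0P[x Sx]] := eqVneq S set0; first exact: connected0.
have -> : S = \bigcup_(y in S) segment x y.
  apply/seteqP; split=> [y Sy|y [z Sz]]; first by exists y => //; exact: segmentR.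
  exact: cS.
apply: bigcup_connected => [|y _]; last exact: plane_segment_connected.
by exists x => y _; exact: segmentL.
Qed.

Lemma component_absorb G z S x : connected_component (~` G) z x ->
  segconv S -> S `<=` ~` G -> S x -> S `<=` connected_component (~` G) z.
Proof.
move=> zx cS SG Sx; rewrite (same_connected_component zx).
by apply: connected_component_max => //; exact: segconv_connected.
Qed.

Lemma component_open G z : closed G -> open (connected_component (~` G) z).
Proof.
move=> cG; rewrite openE => x zx.
have Gx : (~` G) x by apply: connected_component_sub zx.
have : nbhs x (~` G) by apply: open_nbhs_nbhs; split=> //; exact: closed_openC.
move=> /nbhs_ballP[e /= e0 he]; apply/nbhs_ballP; exists e => //=.
apply: (component_absorb zx) => //; first exact: ball_segconv.
exact: ballxx.
Qed.

Lemma segment_closure S x z :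
  (forall t, 0 < t <= 1 -> S (between x z t)) -> closure S x.
Proof.
move=> h U Ux; have := @continuous_between x z 0.
rewrite /continuous_at between0 => /(_ _ Ux) /nbhs_ballP[e /= e0 he].
pose t := Num.min (e / 2) 1.
have t0 : 0 < t by rewrite lt_min ltr01 divr_gt0.
exists (between x z t); split; first by apply: h; rewrite t0 ge_min lexx orbT.
apply: he; rewrite /ball /= sub0r normrN gtr0_norm // gt_min.
by apply/orP; left; lra.
Qed.

Lemma halfplane_unbounded u a S x : det2 u (x - a) < 0 ->
  [set y | det2 u (y - a) < 0] `<=` S -> ~ bounded_set S.
Proof.
move=> hx hS [M [_ hM]].
have {hM} : forall y, S y -> `|y| <= M + 1 by apply: hM; rewrite ltrDl.
(* [w] is [u] turned clockwise by a right angle; [det2 u w] is minus the squared length of [u], so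
   the ray from [x] along [w] runs deeper into the open half-plane. *)
pose w : plane R := \row_k (if k == 0 then u 0 1 else - u 0 0).
have w0 : w 0 0 = u 0 1 by rewrite mxE.
have w1 : w 0 1 = - u 0 0 by rewrite mxE.
have wn0 : w != 0.
  apply/eqP => wE; move: hx; have u1 : u 0 1 = 0 by rewrite -w0 wE mxE.
  have u0 : u 0 0 = 0 by apply/eqP; rewrite -oppr_eq0 -w1 wE mxE.
  by rewrite /det2 u0 u1 !mul0r subrr ltxx.
have h s : 0 <= s -> S (x + s *: w).
  move=> s0; apply: hS; move: hx; rewrite /= /det2 !mxE /=.
  set p := x 0 0; set q := x 0 1 => hx; nra.
move=> hM; pose s := (M + 1 + `|x| + 1) / `|w|.
have nw : 0 < `|w| by rewrite normr_gt0.
have M0 : 0 <= M + 1 by apply: le_trans (hM _ (h 0 (lexx _))).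
have s0 : 0 <= s by rewrite divr_ge0 ?normr_ge0 // addr_ge0 // addr_ge0.
have : `|s *: w| <= `|x + s *: w| + `|x|.
  by rewrite -{1}(addKr x (s *: w)) addrC (le_trans (ler_normB _ _)) // addrC.
rewrite normrZ (ger0_norm s0) /s divfK ?gt_eqF //.
by have := hM _ (h _ s0); rewrite /s => h1 h2; lra.
Qed.

End Topology.

(** * How the closure of a component meets the barrier [G] locally *)

Section Cluster.
Context {R : realType}.
Variables (G : set (plane R)) (z0 : plane R).
Hypothesis closedG : closed G.
Implicit Types (a b c u v w x y z : plane R).
Let C := connected_component (~` G) z0.

Lemma between_ball x y e : 0 < e -> exists2 t, 0 < t <= 1 & ball x e (between x y t).
Proof.
move=> e0; have : closure [set between x y t | t in [set t : R | 0 < t <= 1]] x.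
  by apply: (@segment_closure _ _ _ y) => t ht; exists t.
by move=> /(_ _ (nbhsx_ballx x e e0)) [_ [[t ht <-] hb]]; exists t.
Qed.

Lemma closure_component_segment x z : C z ->
  (forall t, 0 < t <= 1 -> ~ G (between x z t)) -> closure C x.
Proof.
move=> Cz h; apply: (@segment_closure _ _ _ z) => t /andP[t0 t1].
apply: (@component_absorb _ G z0 (segment (between x z t) z) z Cz).
- exact: segment_segconv.
- move=> _ [q /= /andP[q0 q1] <-].
  have -> : between (between x z t) z q = between x z (t + q * (1 - t)).
    by apply: plane_eq; rewrite !betweenE; ring.
  by apply: h; apply/andP; split; nra.
- exact: segmentR.
- exact: segmentL.
Qed.

(** The component is open, so a point of it near [y] can be pushed off both lines while staying in
    it. *)
Lemma closure_component_off_axes y e u1 u2 : closure C y -> 0 < e ->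
  det2 u1 u2 != 0 ->
  exists z, [/\ C z, ball y e z, det2 u1 (z - y) != 0 & det2 u2 (z - y) != 0].
Proof.
move=> Cy e0 D0; set D := det2 u1 u2 in D0 *.
have [z1 [Cz1 bz1]] := Cy _ (nbhsx_ballx y e e0).
have nz1 : nbhs z1 (C `&` ball y e).
  apply: filterI; last by apply: open_nbhs_nbhs; split => //; exact: ball_open.
  by apply: open_nbhs_nbhs; split => //; exact: component_open.
(* The signs make both determinants move away from zero on the way from [z1] to [w]. *)
pose sb : R := if 0 <= det2 u1 (z1 - y) * D then 1 else -1.
pose sa : R := if 0 <= - det2 u2 (z1 - y) * D then 1 else -1.
have D2 : 0 < D ^+ 2 by rewrite exprn_even_gt0.
pose w := z1 + (sa *: u1 + sb *: u2).
have : closure [set z | det2 u1 (z - y) != 0 /\ det2 u2 (z - y) != 0] z1.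
  apply: (@segment_closure _ _ _ w) => t /andP[t0 t1] /=.
  rewrite !det2_between.
  have -> : det2 u1 (w - y) = det2 u1 (z1 - y) + sb * D.
    by rewrite /D /det2 !mxE; ring.
  have -> : det2 u2 (w - y) = det2 u2 (z1 - y) - sa * D.
    by rewrite /D /det2 !mxE; ring.
  split; rewrite -(inj_eq (mulIf D0)) mul0r.
    rewrite /sb; case: ifP => [h|/negbT]; last rewrite -ltNge => h.
      by rewrite gt_eqF //; nra.
    by rewrite lt_eqF //; nra.
  rewrite /sa; case: ifP => [h|/negbT]; last rewrite -ltNge => h.
    by rewrite lt_eqF //; nra.
  by rewrite gt_eqF //; nra.
by move=> /(_ _ nz1) [z [[? ?] [? ?]]]; exists z.
Qed.

(** From a point of the component near [y] and off the line, the segment to [x] meets the line only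
    in [x]. *)
Lemma closure_component_line y e u x : closure C y -> 0 < e -> u != 0 ->
  (forall p, ball y e p -> G p -> det2 u (p - y) = 0) ->
  ball y e x -> G x -> closure C x.
Proof.
move=> Cy e0 un0 hG bx Gx.
pose u2 : plane R := \row_k (if k == 0 then - u 0 1 else u 0 0).
have D0 : det2 u u2 != 0.
  have : 0 < u 0 0 ^+ 2 + u 0 1 ^+ 2.
    rewrite lt0r addr_ge0 ?sqr_ge0 // andbT paddr_eq0 ?sqr_ge0 // !sqrf_eq0.
    apply: contra un0 => /andP[/eqP h0 /eqP h1].
    by apply/eqP/plane_eq; rewrite ?h0 ?h1 mxE.
  by move=> h; rewrite /det2 !mxE /= gt_eqF //; lra.
have [z [Cz bz h1 _]] := closure_component_off_axes Cy e0 D0.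
apply: (closure_component_segment Cz) => t /andP[t0 t1] Gp.
have bp : ball y e (between x z t).
  by apply: (ball_segconv bx bz); exists t => //=; rewrite t1 ltW.
have := hG _ bp Gp; rewrite det2_between (hG _ bx Gx) mulr0 add0r => /eqP.
by rewrite mulf_eq0 gt_eqF //= (negbTE h1).
Qed.

(** The two rays cut a small ball into a convex and a reflex sector. From either sector the first
    ray can be reached, if need be by going round [y]. *)
Lemma closure_component_ray y e u1 u2 (a : R) : closure C y -> 0 < e ->
  det2 u1 u2 != 0 ->
  (forall p, ball y e p -> G p ->
     exists2 s, 0 <= s & p = y + s *: u1 \/ p = y + s *: u2) ->
  0 <= a -> ball y e (y + a *: u1) -> closure C (y + a *: u1).
Proof.
move=> Cy e0 D0 hG a0 bx; set x := y + a *: u1 in bx *; set D := det2 u1 u2 in D0.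
(* [al] and [be] are the coordinates of [z - y] in the basis [u1], [u2]. *)
pose be z := det2 u1 (z - y) / D; pose al z := - det2 u2 (z - y) / D.
have beE p q t : be (between p q t) = (1 - t) * be p + t * be q.
  by rewrite /be det2_between; field.
have alE p q t : al (between p q t) = (1 - t) * al p + t * al q.
  by rewrite /al det2_between; field.
have ray1 s : be (y + s *: u1) = 0 /\ al (y + s *: u1) = s.
  have D0' := D0; rewrite /be /al /D /det2 !mxE.
  by split; rewrite /D /det2 in D0' *; field.
have ray2 s : be (y + s *: u2) = s /\ al (y + s *: u2) = 0.
  have D0' := D0; rewrite /be /al /D /det2 !mxE.
  by split; rewrite /D /det2 in D0' *; field.
(* Before reaching [x], the segment from such a [z] keeps [be < 0], or keeps [be != 0] and [al > 0];
   either rules out both rays. *)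
have good z : C z -> ball y e z -> be z < 0 \/ be z != 0 /\ 0 < al z -> closure C x.
  move=> Cz bz hz; apply: (closure_component_segment Cz) => t /andP[t0 t1] Gp.
  have bp : ball y e (between x z t).
    by apply: (ball_segconv bx bz); exists t => //=; rewrite t1 ltW.
  have [s s0 [ps|ps]] := hG _ bp Gp.
    have := beE x z t; rewrite ps (ray1 s).1 (ray1 a).1 mulr0 add0r => /esym/eqP.
    rewrite mulf_eq0 gt_eqF //=; case: hz => [h|[h _]]; last by rewrite (negbTE h).
    by rewrite lt_eqF.
  have := beE x z t; have := alE x z t.
  rewrite ps (ray2 s).1 (ray2 s).2 (ray1 a).1 (ray1 a).2 => h1 h2.
  by case: hz => [h|[_ h]]; nra.
have [z [Cz bz h1 h2]] := closure_component_off_axes Cy e0 D0.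
have bez : be z != 0 by rewrite mulf_neq0 // invr_neq0.
have alz : al z != 0 by rewrite mulf_neq0 ?oppr_eq0 // invr_neq0.
have [|be0] := ltP (be z) 0; first by move=> h; apply: (good z) => //; left.
have [|al0] := ltP 0 (al z); first by move=> h; apply: (good z) => //; right.
have {}al0 : al z < 0 by rewrite lt_neqAle alz.
(* What remains is [al < 0 < be], where the second ray may hide [x]. The half-plane [al < 0] meets
   neither ray, so [z] can be moved through it to a point [z'] with [be < 0]. *)
have [t /andP[t0 t1] bz'] := @between_ball y (y - u1 - u2) e e0.
set z' := between _ _ _ in bz'.
have z'E : be z' = - t /\ al z' = - t.
  have D0' := D0; rewrite /z' beE alE /be /al /D /det2 !mxE.
  by split; rewrite /D /det2 in D0' *; field.
apply: (good z') => //; last by left; lra.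
apply: (component_absorb Cz (@segment_segconv _ z z')); last exact: segmentR.
  move=> _ [q /= /andP[q0 q1] <-] Gp.
  have bp : ball y e (between z z' q).
    by apply: (ball_segconv bz bz'); exists q => //=; rewrite q1 q0.
  have hal : 0 < - al (between z z' q).
    have -> : - al (between z z' q) = (1 - q) * - al z + q * - al z' by rewrite alE; ring.
    by apply: convex_comb_gt0; rewrite ?oppr_gt0 // z'E.2; lra.
  have [s s0 [ps|ps]] := hG _ bp Gp; move: hal; rewrite ps ?(ray1 s).2 ?(ray2 s).2; lra.
exact: segmentL.
Qed.

End Cluster.

(** * Boundary of a simple polygon *)

Section PolygonBoundary.
Context {R : realType}.
Variable P : polygon R.
Local Notation G := (polygon_boundary P).
Local Notation v := (vertex (p := P)).
Local Notation edge i := (segment (v i) (v (ordS i))).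

Lemma boundary_closed : closed G.
Proof.
apply: closed_bigcup => [|i _]; last exact: segment_closed.
exact: finite_finset.
Qed.

Lemma edge_vector_neq0 i : v (ordS i) - v i != 0.
Proof.
apply/negP; rewrite subr_eq0 => /eqP vE.
have h0 : 0 <= (0 : R) < 1 by rewrite lexx ltr01.
have h1 : 0 <= (2^-1 : R) < 1 by rewrite invr_ge0 ler0n invf_lt1 ?ltr1n ?ltr0n.
have [|_] := @polygon_simple _ P i i _ _ h0 h1.
  by rewrite vE; apply: plane_eq; rewrite !betweenE; ring.
by move/esym/eqP; rewrite invr_eq0 pnatr_eq0.
Qed.

(** The finitely many closed edges that miss the point also miss a neighbourhood of it; injectivity
    of the chain identifies those that contain it. A vertex is counted with its outgoing edge,
    whence [s < 1]. *)
Lemma boundary_near i s : 0 <= s < 1 ->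
  \forall x \near between (v i) (v (ordS i)) s,
    G x -> edge i x \/ s = 0 /\ edge (ord_pred i) x.
Proof.
move=> hs; set y := between _ _ _.
have near_y : \forall x \near y, forall j, edge j x -> edge j y.
  apply: (@filter_forall _ _ (fun j x => edge j x -> edge j y) (nbhs y) _) => j.
  have [ey|ney] := pselect (edge j y).
    by apply: filterE => x _.
  have : nbhs y (~` edge j).
    by apply: open_nbhs_nbhs; split => //; apply/closed_openC/segment_closed.
  by apply: filterS => x nex /nex.
apply: filterS near_y => x hx [j _ jx].
have [t /= /andP[t0 t1] tE] := hx j jx.
have [t1'|t1'] := ltP t 1.
  have ht : 0 <= t < 1 by rewrite t0.
  by have [ji _] := @polygon_simple _ P _ _ _ _ ht hs tE; left; rewrite -ji.
(* The point is the end of edge [j], hence the start of edge [ordS j], to which injectivity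
   applies. *)
have t1E : t = 1 by apply/eqP; rewrite eq_le t1.
have h0 : 0 <= (0 : R) < 1 by rewrite lexx ltr01.
have [|ji s0] := @polygon_simple _ P (ordS j) i _ _ h0 hs.
  by rewrite between0 -/y -tE t1E between1.
by right; rewrite -ji ordSK; split.
Qed.

(** Near an inner point of an edge, or a vertex with collinear edges, the boundary lies in a line;
    near any other vertex it lies in two independent rays. *)
Lemma closure_component_boundary_near z0 y :
  let C := connected_component (~` G) z0 in
  G y -> closure C y -> \forall x \near y, G x -> closure C x.
Proof.
move=> C [i0 _ [s0 /= /andP[s00 s01] y0E]] Cy.
have [i [s hs yE]] : exists i, exists2 s, 0 <= s < 1 & y = between (v i) (v (ordS i)) s.
  have [s1|s1] := ltP s0 1; first by exists i0, s0; rewrite // s00.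
  exists (ordS i0), 0; first by rewrite lexx ltr01.
  by rewrite between0 -y0E (_ : s0 = 1) ?between1 //; apply/eqP; rewrite eq_le s01.
have := boundary_near i hs; rewrite -yE => /nbhs_ballP[e /= e0 he].
have cG := boundary_closed.
pose u1 := v (ordS i) - v i.
have line p : edge i p -> det2 u1 (p - y) = 0.
  by move=> [t _ <-]; rewrite yE /u1 /det2 !mxE; ring.
have allline : (forall p, ball y e p -> G p -> det2 u1 (p - y) = 0) ->
    \forall x \near y, G x -> closure C x.
  move=> hl; apply: filterS (nbhsx_ballx y e e0) => x bx Gx.
  exact: (closure_component_line cG Cy e0 (edge_vector_neq0 i) hl).
have [sE|sn0] := eqVneq s 0; last first.
  apply: allline => p bp Gp; have [/line //|[sE _]] := he p bp Gp.
  by rewrite sE eqxx in sn0.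
move: yE; rewrite sE between0 => yE.
pose j := ord_pred i; pose u2 := v j - v i.
have [D0|D0] := eqVneq (det2 u1 u2) 0.
  apply: allline => p bp Gp; have [/line //|[_ [t _ <-]]] := he p bp Gp.
  have -> : det2 u1 (between (v (ord_pred i)) (v (ordS (ord_pred i))) t - y)
      = (1 - t) * det2 u1 u2.
    by rewrite ord_predK yE /u1 /u2 /j /det2 !mxE; ring.
  by rewrite D0 mulr0.
have rays p : ball y e p -> G p ->
    exists2 s, 0 <= s & p = y + s *: u1 \/ p = y + s *: u2.
  move=> bp Gp; have [|[_]] := he p bp Gp.
    move=> [t /= /andP[t0 t1] <-]; exists t => //; left.
    by apply: plane_eq; rewrite betweenE yE /u1 !mxE; ring.
  move=> [t /= /andP[t0 t1] <-]; exists (1 - t); first by lra.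
  by right; apply: plane_eq; rewrite betweenE ord_predK yE /u2 /j !mxE; ring.
apply: filterS (nbhsx_ballx y e e0) => x bx Gx.
have [a a0 [xE|xE]] := rays x bx Gx; rewrite xE in bx *.
  exact: (closure_component_ray cG Cy e0 D0 rays).
apply: (closure_component_ray cG Cy e0 _ _ a0 bx (u2 := u1)).
  by apply: contra D0; rewrite /det2 => /eqP h; apply/eqP; lra.
by move=> p bp Gp; have [t t0 [?|?]] := rays p bp Gp; exists t => //; [right|left].
Qed.

Lemma closure_component_edge z0 i :
  let C := connected_component (~` G) z0 in
  edge i `&` closure C !=set0 -> edge i `<=` closure C.
Proof.
move=> C hne; suff : edge i `&` closure C = edge i by move=> <- x [].
apply: (plane_segment_connected hne).
  exists (interior [set x | G x -> closure C x]); first exact: open_interior.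
  apply/seteqP; split=> x [ex hx]; split => //.
    by apply: closure_component_boundary_near => //; exists i.
  by apply: (interior_subset hx); exists i.
by exists (closure C) => //; exact: closed_closure.
Qed.

Lemma ordS_iter_surj (i j : 'I_(polygon_size P)) : exists k, iter k (@ordS _) i = j.
Proof.
have val_iter k : val (iter k (@ordS _) i) = ((i + k) %% polygon_size P)%N.
  elim: k => [|k IHk]; first by rewrite addn0 modn_small.
  by rewrite iterS /= IHk addnS -addn1 modnDml addn1.
exists (j + (polygon_size P - i))%N; apply: val_inj; rewrite val_iter.
by rewrite addnCA subnKC ?modnDr ?modn_small // ltnW.
Qed.

(* The points of the boundary in the closure of the component form a closed set,
   which is also open, because near each of its points the boundary is contained
   in a line or in two rays. *)
Lemma boundary_sub_closure_component z0 : (~` G) z0 ->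
  G `<=` closure (connected_component (~` G) z0).
Proof.
move=> Gz0; set C := connected_component _ _.
have Cz0 : C z0 by exact: connected_component_refl.
have [y Gy Cy] : exists2 y, G y & closure C y.
  (* Otherwise the component would be open and closed, hence the whole plane, although it avoids the
     vertices. *)
  apply: contrapT => h.
  have clC : closure C `<=` C.
    apply: connected_component_max; first exact: subset_closure.
      by move=> y Cy Gy; apply: h; exists y.
    exact/connected_closure/component_connected.
  have CT : C = setT.
    apply: (@segconv_connected R setT) => //; first by exists z0.
      by exists C; rewrite ?setTI //; apply: component_open; exact: boundary_closed.
    exists (closure C); first exact: closed_closure.
    by rewrite setTI; apply/seteqP; split => //; exact: subset_closure.
  have i0 : 'I_(polygon_size P) by apply: (@Ordinal _ 0); apply: ltn_trans (polygon_size_ge3 P).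
  have : C (v i0) by rewrite CT.
  move=> /connected_component_sub; apply; exists i0 => //; exact: segmentL.
have [i _ iy] := Gy.
(* Walk round the polygon: consecutive edges share a vertex. *)
have vi k : closure C (v (iter k (@ordS _) (ordS i))).
  elim: k => [|k IHk].
    by apply: (@closure_component_edge z0 i); [exists y|exact: segmentR].
  apply: (@closure_component_edge z0 (iter k (@ordS _) (ordS i))); last exact: segmentR.
  by exists (v (iter k (@ordS _) (ordS i))); split => //; exact: segmentL.
move=> x [j _ jx]; apply: (@closure_component_edge z0 j) jx.
have [k kE] := ordS_iter_surj (ordS i) j.
by exists (v j); split; [exact: segmentL|rewrite -kE; exact: vi].
Qed.

(* From a point outside the half-plane a ray leads to infinity. *)
Lemma halfplane_region u a : (forall i, 0 <= det2 u (v i - a)) ->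
  polygon_region P `<=` [set x | 0 <= det2 u (x - a)].
Proof.
move=> hv; have hG : G `<=` [set x | 0 <= det2 u (x - a)].
  by move=> x [i _ ix]; apply: (halfplane_segconv (x := v i) (y := v (ordS i))) ix => /=.
move=> x [[Gx bx]|/hG //] /=; rewrite leNgt; apply/negP => hx.
apply: (halfplane_unbounded hx) bx.
apply: connected_component_max => //; last first.
  exact/segconv_connected/open_halfplane_segconv.
by move=> y /= hy /hG /=; rewrite leNgt hy.
Qed.

End PolygonBoundary.

(** * Barycentric coordinates and inradius *)

Section Barycentric.
Context {R : realType}.
Implicit Types (a b c u v w x y z : plane R).

Definition area2 a b c : R := det2 (b - a) (c - a).

Lemma area2C a b c : area2 b c a = area2 a b c.
Proof. by rewrite /area2 /det2 !mxE; ring. Qed.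

(* The barycentric coordinate of [x] at the first vertex [a]. *)
Definition bary a b c x : R := det2 (c - b) (x - b) / area2 a b c.

Lemma baryE a b c x : area2 a b c != 0 ->
  x = bary a b c x *: a + bary b c a x *: b + bary c a b x *: c.
Proof.
rewrite /bary (area2C b c a) (area2C a b c) => D0.
apply: plane_eq; rewrite !mxE; move: D0; rewrite /area2 /det2 !mxE => D0; by field.
Qed.

Lemma bary_sum a b c x : area2 a b c != 0 ->
  bary a b c x + bary b c a x + bary c a b x = 1.
Proof.
rewrite /bary (area2C b c a) (area2C a b c) => D0.
move: D0; rewrite /area2 /det2 !mxE => D0; by field.
Qed.

Lemma bary_comb a b c s t q : area2 a b c != 0 -> s + t + q = 1 ->
  bary a b c (s *: a + t *: b + q *: c) = s.
Proof.
move=> D0 h; have {h} -> : q = 1 - s - t by lra.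
by move: D0; rewrite /bary /area2 /det2 !mxE => D0; field.
Qed.

Lemma tri_rot a b c : tri a b c `<=` tri b c a.
Proof.
move=> _ [s [t [q [s0 t0 q0 h ->]]]]; exists t, q, s; split=> //; first by lra.
by rewrite -addrA addrC.
Qed.

Lemma tri_bary_ge0 a b c x : area2 a b c != 0 -> tri a b c x -> 0 <= bary a b c x.
Proof.
by move=> D0 [s [t [q [s0 t0 q0 h ->]]]]; rewrite bary_comb.
Qed.

Lemma triP a b c x : area2 a b c != 0 ->
  tri a b c x <-> [/\ 0 <= bary a b c x, 0 <= bary b c a x & 0 <= bary c a b x].
Proof.
move=> D0; split=> [h|[h1 h2 h3]].
  split; first exact: tri_bary_ge0.
    by apply: tri_bary_ge0; [rewrite area2C|exact: tri_rot].
  by apply: tri_bary_ge0; [rewrite -area2C|exact/tri_rot/tri_rot].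
exists (bary a b c x), (bary b c a x), (bary c a b x).
by split=> //; [exact: bary_sum|exact: baryE].
Qed.

Lemma continuous_bary a b c : continuous (bary a b c).
Proof.
move=> x.
have coord k : (fun y : plane R => y 0 k) @ x --> (x : plane R) 0 k.
  exact: coord_continuous.
have coordB k : (fun y : plane R => y 0 k - b 0 k) @ x --> (x : plane R) 0 k - b 0 k.
  exact: (cvgB (coord k) (cvg_cst _)).
have -> : bary a b c = (fun y : plane R => ((c 0 0 - b 0 0) * (y 0 1 - b 0 1) -
    (c 0 1 - b 0 1) * (y 0 0 - b 0 0)) * (area2 a b c)^-1).
  by apply/funext => y; rewrite /bary /det2 !mxE.
exact: (cvgM (cvgB (cvgM (cvg_cst _) (coordB _)) (cvgM (cvg_cst _) (coordB _)))
  (cvg_cst _)).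
Qed.

Lemma bary_gt0_open a b c : open [set x | 0 < bary a b c x].
Proof.
by apply: (open_comp _ (@open_gt R 0)) => x _; exact: continuous_bary.
Qed.

Lemma bary_ge0_closed a b c : closed [set x | 0 <= bary a b c x].
Proof.
by apply: (closed_comp _ (@closed_ge R 0)) => x _; exact: continuous_bary.
Qed.

Lemma tri_closed a b c : area2 a b c != 0 -> closed (tri a b c).
Proof.
move=> D0; have -> : tri a b c = [set x | 0 <= bary a b c x] `&`
    ([set x | 0 <= bary b c a x] `&` [set x | 0 <= bary c a b x]).
  apply/seteqP; split=> x; first by move/(triP _ D0)=> [].
  by move=> [? [? ?]]; apply/(triP _ D0).
by apply: closedI; [|apply: closedI]; exact: bary_ge0_closed.
Qed.

Lemma bary_eq0_segment a b c x : area2 a b c != 0 -> tri a b c x ->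
  bary a b c x = 0 -> segment b c x.
Proof.
move=> D0 /(triP _ D0)[_ h2 h3] h1; have := bary_sum x D0; have := baryE x D0.
rewrite h1 scale0r !add0r => xE sE; exists (bary c a b x); last first.
  by rewrite [RHS]xE /between (_ : 1 - _ = bary b c a x) //; lra.
by apply/andP; split; lra.
Qed.

Definition tri_interior a b c : set (plane R) := [set x | 0 < bary a b c x] `&`
    ([set x | 0 < bary b c a x] `&` [set x | 0 < bary c a b x]).

Lemma open_tri_interior a b c : open (tri_interior a b c).
Proof. by apply: openI; [|apply: openI]; exact: bary_gt0_open. Qed.

Lemma tri_interior_sub a b c : area2 a b c != 0 -> tri_interior a b c `<=` tri a b c.
Proof. by move=> D0 x [? [? ?]]; apply/(triP _ D0); split; exact: ltW. Qed.

(** Since [C] misses the sides, it meets the closed and the open triangle in the same set, which is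
    therefore open and closed in [C]. *)
Lemma connected_sub_tri a b c C : area2 a b c != 0 -> connected C ->
  C `&` tri a b c !=set0 -> (forall x, C x -> segment a b x -> False) ->
  (forall x, C x -> segment b c x -> False) ->
  (forall x, C x -> segment c a x -> False) -> C `<=` tri a b c.
Proof.
move=> D0 cC ne hab hbc hca; suff : C `&` tri a b c = C by move=> <- x [].
apply: (cC _ ne); last by exists (tri a b c) => //; exact: tri_closed.
exists (tri_interior a b c); first exact: open_tri_interior.
apply/seteqP; split=> x [Cx tx]; split => //; last exact: tri_interior_sub.
have [h1 h2 h3] := (triP x D0).1 tx.
have D1 : area2 b c a != 0 by rewrite area2C.
have D2 : area2 c a b != 0 by rewrite area2C.
split => /=; [|split => /=]; rewrite lt0r ?h1 ?h2 ?h3 andbT; apply/eqP => h.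
- by apply: (hbc x) => //; apply: (bary_eq0_segment D0).
- by apply: (hca x) => //; apply: (bary_eq0_segment D1) => //; apply: tri_rot.
- by apply: (hab x) => //; apply: (bary_eq0_segment D2) => //; exact/tri_rot/tri_rot.
Qed.

Lemma dist_sqr x y : dist x y ^+ 2 = (x 0 0 - y 0 0) ^+ 2 + (x 0 1 - y 0 1) ^+ 2.
Proof.
rewrite /dist sqr_sqrtr; last by rewrite sumr_ge0 // => i _; rewrite sqr_ge0.
rewrite big_ord_recl big_ord1; congr (_ + (x 0 _ - y 0 _) ^+ 2); exact: val_inj.
Qed.

Lemma dist_ge0 x y : 0 <= dist x y.
Proof. exact: sqrtr_ge0. Qed.

Lemma distC x y : dist x y = dist y x.
Proof.
by apply/eqP; rewrite -(@eqrXn2 _ 2) ?dist_ge0 // !dist_sqr; apply/eqP; ring.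
Qed.

Lemma dist_le x y (m : R) : 0 <= m ->
  (dist x y <= m) = ((x 0 0 - y 0 0) ^+ 2 + (x 0 1 - y 0 1) ^+ 2 <= m ^+ 2).
Proof. by move=> m0; rewrite -dist_sqr ler_sqr // nnegrE dist_ge0. Qed.

Lemma heron a b c :
  let p := dist c a in let q := dist b c in let r := dist a b in
  4%:R * area2 a b c ^+ 2 = (p + q + r) * (p + q - r) * (p - q + r) * (q - p + r).
Proof.
(* Once expanded, the product contains only even powers of the distances, so the square roots
   disappear. *)
move=> p q r; transitivity (2%:R * p ^+ 2 * q ^+ 2 + 2%:R * p ^+ 2 * r ^+ 2 +
   2%:R * q ^+ 2 * r ^+ 2 - (p ^+ 2) ^+ 2 - (q ^+ 2) ^+ 2 - (r ^+ 2) ^+ 2); last by ring.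
by rewrite /p /q /r !dist_sqr /area2 /det2 !mxE; ring.
Qed.

(** Moving from the centre by [rho] perpendicularly towards [b c] lowers the barycentric coordinate
    at [a] by [rho * dist b c / |area2 a b c|], and it is still nonnegative there. *)
Lemma disc_bary a b c c0 rho : area2 a b c != 0 -> 0 <= rho ->
  disc c0 rho `<=` tri a b c ->
  rho * dist b c <= `|area2 a b c| * bary a b c c0.
Proof.
move=> D0 rho0 hd; have nD0 : 0 < `|area2 a b c| by rewrite normr_gt0.
have cc : disc c0 rho c0 by rewrite /disc /= dist_le // !subrr expr0n addr0 sqr_ge0.
have [->|e0] := eqVneq (dist b c) 0.
  by rewrite mulr0 mulr_ge0 ?(tri_bary_ge0 D0) //; exact: hd.
set e := dist b c in e0 *.
(* The sign of the area directs the displacement towards [b c] for either orientation. *)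
pose k := Num.sg (area2 a b c) * (rho / e).
pose x : plane R := c0 + k *: (\row_i (if i == 0 then c 0 1 - b 0 1 else b 0 0 - c 0 0)).
have e2 : e ^+ 2 = (c 0 0 - b 0 0) ^+ 2 + (c 0 1 - b 0 1) ^+ 2.
  by rewrite dist_sqr; ring.
have k2 : k ^+ 2 * e ^+ 2 = rho ^+ 2.
  by rewrite /k exprMn sqr_sg D0 mul1r expr_div_n divfK // expf_neq0.
have xd : disc c0 rho x.
  rewrite /disc /= dist_le // -k2 e2 /x !mxE /= le_eqVlt.
  by apply/orP; left; apply/eqP; ring.
have := tri_bary_ge0 D0 (hd _ xd).
have -> : bary a b c x = bary a b c c0 - k * e ^+ 2 / area2 a b c.
  by rewrite e2 /bary -mulrBl; congr (_ / _); rewrite /det2 /x !mxE /=; ring.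
rewrite /k subr_ge0.
have -> : Num.sg (area2 a b c) * (rho / e) * e ^+ 2 / area2 a b c =
    rho * e / `|area2 a b c|.
  have sgE : `|area2 a b c|^-1 * area2 a b c = Num.sg (area2 a b c).
    by rewrite [X in _ * X]numEsg mulrCA mulVf ?mulr1 // gt_eqF.
  by apply: (mulIf D0); rewrite divfK // -[RHS]mulrA sgE; field.
by rewrite ler_pdivrMr // [X in _ <= X]mulrC.
Qed.

(** The three bounds of [disc_bary] are added, the coordinates having sum 1. The incircle attains
    equality: the inradius is [|area2 a b c|] over the perimeter. *)
Lemma disc_perimeter a b c c0 rho : area2 a b c != 0 -> 0 <= rho ->
  disc c0 rho `<=` tri a b c ->
  rho * (dist c a + dist b c + dist a b) <= `|area2 a b c|.
Proof.
move=> D0 rho0 h1.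
have D1 : area2 b c a != 0 by rewrite area2C.
have D2 : area2 c a b != 0 by rewrite area2C.
have h2 : disc c0 rho `<=` tri b c a by move=> x /h1 /tri_rot.
have h3 : disc c0 rho `<=` tri c a b by move=> x /h2 /tri_rot.
have := disc_bary D0 rho0 h1; have := disc_bary D1 rho0 h2; have := disc_bary D2 rho0 h3.
have := bary_sum c0 D0; rewrite (area2C b c a) (area2C a b c) => sE i1 i2 i3.
have -> : `|area2 a b c| = `|area2 a b c| * (bary a b c c0 + bary b c a c0 + bary c a b c0).
  by rewrite sE mulr1.
lra.
Qed.

End Barycentric.

(** * Bounds for the inradius of the convex hull of a polygon *)

Section Irch.
Context {R : realType}.
Variable P : polygon R.
Local Notation v := (vertex (p := P)).

Lemma perimeter_gt0 (a b c : plane R) : area2 a b c != 0 ->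
  0 < dist c a + dist b c + dist a b.
Proof.
move=> D0; rewrite lt0r !addr_ge0 ?dist_ge0 // andbT; apply: contra D0 => /eqP s0.
have := heron a b c; rewrite /= s0 !mul0r => /eqP.
by rewrite mulf_eq0 pnatr_eq0 /= sqrf_eq0.
Qed.

Lemma vertex_boundary i : polygon_boundary P (v i).
Proof. by exists i => //; exact: segmentL. Qed.

(** The triangle is an intersection of three half-planes, each containing the region by
    [halfplane_region]; being convex it contains the hull, and [disc_perimeter] bounds every disc
    there. *)
Lemma irch_le_tri (a b c : plane R) : area2 a b c != 0 ->
  polygon_boundary P `<=` tri a b c ->
  irch P <= `|area2 a b c| / (dist c a + dist b c + dist a b).
Proof.
move=> D0 hP; set p := _ + _ + _; have p0 : 0 < p by exact: perimeter_gt0.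
have half (a' b' c' : plane R) : (forall x, tri a b c x -> 0 <= bary a' b' c' x) ->
    polygon_region P `<=` [set x | 0 <= bary a' b' c' x].
  move=> h; pose u := (area2 a' b' c')^-1 *: (c' - b').
  have baryu x : det2 u (x - b') = bary a' b' c' x.
    by rewrite /bary /u /det2 !mxE; ring.
  move=> x Px; rewrite /= -baryu; apply: (@halfplane_region _ P) Px => i.
  by rewrite baryu; apply: h; apply: hP; exact: vertex_boundary.
have hull_tri : convex_hull (polygon_region P) `<=` tri a b c.
  apply: hull_min => [|x Px]; first exact: tri_segconv.
  apply/triP => //; split; apply: (half _ _ _ _ x Px) => y hy.
  - exact: tri_bary_ge0.
  - by apply: tri_bary_ge0; [rewrite area2C|exact: tri_rot].
  - by apply: tri_bary_ge0; [rewrite -area2C|exact/tri_rot/tri_rot].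
apply: ge_sup => [|rho [rho0 [c0 hc0]]]; last first.
  rewrite ler_pdivlMr //; apply: (disc_perimeter D0 rho0 (c0 := c0)).
  exact: subset_trans hc0 hull_tri.
(* The disc of radius zero at a vertex makes the set of radii nonempty, as the bound on [sup]
   requires. *)
pose i0 : 'I_(polygon_size P) := Ordinal (ltn_trans (ltn0Sn 1) (polygon_size_ge3 P)).
exists 0; split=> //; exists (v i0) => x; rewrite /disc /= dist_le // expr0n /= => hx.
have h0 : x = v i0.
  have h1 := sqr_ge0 (v i0 0 0 - x 0 0); have h2 := sqr_ge0 (v i0 0 1 - x 0 1).
  by apply: plane_eq; apply/esym/eqP; rewrite -subr_eq0 -sqrf_eq0 eq_le;
    apply/andP; split => //; lra.
by rewrite h0; apply: sub_hull; right; exact: vertex_boundary.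
Qed.

(* A vertex farthest from the origin cannot lie between its neighbours; were
   it collinear with them, the two edges at this vertex would overlap. *)
Lemma noncollinear_vertices : exists i, area2 (v i) (v (ordS i)) (v (ord_pred i)) != 0.
Proof.
pose i0 : 'I_(polygon_size P) := Ordinal (ltn_trans (ltn0Sn 1) (polygon_size_ge3 P)).
pose f i := v i 0 0 ^+ 2 + v i 0 1 ^+ 2.
pose i := [arg max_(j > i0) f j]%O.
have fi j : f j <= f i by rewrite /i; case: arg_maxP => // k _; apply.
exists i; apply/eqP => D0.
pose u1 := v (ordS i) - v i; pose u2 := v (ord_pred i) - v i.
have u1n0 : u1 != 0 by exact: edge_vector_neq0.
have u2n0 : u2 != 0.
  rewrite /u2 -opprB oppr_eq0 -{1}(ord_predK i); exact: edge_vector_neq0.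
have [k kE] : exists k, u2 = k *: u1.
  have [h0|h0] := eqVneq (u1 0 0) 0; last first.
    exists (u2 0 0 / u1 0 0); apply: plane_eq; rewrite [RHS]mxE ?divfK //.
    by apply: (mulIf h0); move: D0; rewrite /area2 /det2 -/u1 -/u2 => D0;
      rewrite [RHS]mulrAC divfK //; lra.
  have h1 : u1 0 1 != 0.
    by apply: contra u1n0 => /eqP h1; apply/eqP/plane_eq; rewrite ?h0 ?h1 mxE.
  exists (u2 0 1 / u1 0 1); apply: plane_eq; rewrite [RHS]mxE ?divfK // h0 mulr0.
  apply: (mulIf h1); move: D0; rewrite /area2 /det2 -/u1 -/u2 h0; lra.
have s1 : ordS i != i.
  by apply: contra u1n0 => /eqP h; rewrite /u1 h subrr.
have [k0|k0] := ltP 0 k.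
  have hk : 0 < k + 1 by rewrite addr_gt0.
  (* The neighbours lie on the same side of [v i]; at this parameter both edges pass through
     [v i + (k / (k + 1)) *: u1]. *)
  have ht : 0 <= k / (k + 1) < 1.
    by rewrite divr_ge0 ?ltW //= ltr_pdivrMr // mul1r ltrDl.
  have [|h _] := @polygon_simple _ P i (ord_pred i) _ _ ht ht.
    have v1 : v (ordS i) = v i + u1 by rewrite /u1 addrC subrK.
    have v2 : v (ord_pred i) = v i + k *: u1 by rewrite -kE /u2 addrC subrK.
    rewrite ord_predK v1 v2; apply: plane_eq; rewrite !betweenE !mxE; field; exact: lt0r_neq0.
  by rewrite {1}h ord_predK eqxx in s1.
have := fi (ordS i); have := fi (ord_pred i); rewrite /f.
have -> : v (ordS i) = v i + u1 by rewrite /u1 addrC subrK.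
have -> : v (ord_pred i) = v i + k *: u1 by rewrite -kE /u2 addrC subrK.
clearbody u1 u2; rewrite !mxE; set p := v i 0 0; set q := v i 0 1; set m := u1 0 0; set n := u1 0 1.
have mn : 0 < m ^+ 2 + n ^+ 2.
  rewrite lt0r addr_ge0 ?sqr_ge0 // andbT paddr_eq0 ?sqr_ge0 // !sqrf_eq0.
  apply: contra u1n0 => /andP[/eqP h0 /eqP h1].
  by apply/eqP/plane_eq; rewrite -?/m -?/n ?h0 ?h1 mxE.
have kn0 : k != 0 by apply: contra u2n0 => /eqP k0'; rewrite kE k0' scale0r.
have {}k0 : k < 0 by rewrite lt_neqAle kn0.
move=> h2 h1.
(* The neighbours lie on opposite sides of [v i]; the squared norm is strictly convex along their
   line, so it cannot be largest at [v i]. *)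
have {}h1 : 2%:R * (p * m + q * n) + (m ^+ 2 + n ^+ 2) <= 0 by lra.
have {}h2 : 0 <= 2%:R * (p * m + q * n) + k * (m ^+ 2 + n ^+ 2).
  by rewrite -(nmulr_rle0 _ k0); lra.
have : k * (m ^+ 2 + n ^+ 2) < 0 by rewrite nmulr_rlt0.
lra.
Qed.

(** A triangle on three noncollinear vertices contains a disc about its centroid. The radii are
    bounded because the hull lies in a vertical strip, so [sup] is a genuine supremum and not its
    default value. *)
Lemma irch_gt0 : 0 < irch P.
Proof.
have [i D0] := noncollinear_vertices.
set a := v i in D0; set b := v (ordS i) in D0; set c := v (ord_pred i) in D0.
have hull_v j : convex_hull (polygon_region P) (v j).
  by apply: sub_hull; right; exact: vertex_boundary.
have tri_hull : tri a b c `<=` convex_hull (polygon_region P).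
  by apply: tri_min; [exact: hull_segconv|exact: hull_v..].
pose g := 3%:R^-1 *: a + 3%:R^-1 *: b + 3%:R^-1 *: c.
have third : 3%:R^-1 + 3%:R^-1 + 3%:R^-1 = 1 :> R by field.
have gi : tri_interior a b c g.
  have D1 : area2 b c a != 0 by rewrite area2C.
  have D2 : area2 c a b != 0 by rewrite area2C.
  have t0 : 0 < 3%:R^-1 :> R by rewrite invr_gt0 ltr0n.
  split; [|split] => /=; first by rewrite bary_comb.
    by rewrite /g -addrA addrC bary_comb.
  by rewrite /g addrC addrA bary_comb.
have : nbhs g (tri_interior a b c) by apply: open_nbhs_nbhs; split; [exact: open_tri_interior|].
move=> /nbhs_ballP[e /= e0 he].
rewrite /irch; set A := (X in sup X); have e2p : 0 <= e / 2 by rewrite divr_ge0 // ltW.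
(* [ball] refers to the sup norm; halving the radius puts the closed Euclidean disc inside the open
   ball. *)
have Ae : A (e / 2).
  split=> //; exists g; apply: subset_trans tri_hull; apply: subset_trans (tri_interior_sub D0).
  apply: subset_trans he => x; rewrite /disc /= dist_le // => hx.
  apply/plane_ballP; split=> // k; rewrite ltNge; apply/negP => hk.
  have h1 := sqr_ge0 (g 0 0 - x 0 0); have h2 := sqr_ge0 (g 0 1 - x 0 1).
  have : e ^+ 2 <= `|g 0 k - x 0 k| ^+ 2 by rewrite ler_sqr ?nnegrE ?(ltW e0).
  rewrite real_normK ?num_real //.
  have e2 : 0 < e ^+ 2 by rewrite exprn_gt0.
  have e4 : (e / 2) ^+ 2 = e ^+ 2 / 4%:R by field.
  by rewrite e4 in hx; case: (ord2P k) => ->; lra.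
apply: lt_le_trans (_ : e / 2 <= _); first by rewrite divr_gt0.
apply: ub_le_sup => //; pose M := \sum_i `|v i 0 0|.
have vM j : `|v j 0 0| <= M.
  by rewrite /M (bigD1 j) //= lerDl sumr_ge0.
pose e1 (s t : R) : plane R := \row_k (if k == 0 then s else t).
have hull_strip x : convex_hull (polygon_region P) x -> - M <= x 0 0 /\ x 0 0 <= M.
  have E1 (y : plane R) : det2 (e1 0 (-1)) (y - e1 (- M) 0) = y 0 0 + M.
    by rewrite /det2 !mxE /=; ring.
  have E2 (y : plane R) : det2 (e1 0 1) (y - e1 M 0) = M - y 0 0.
    by rewrite /det2 !mxE /=; ring.
  move=> hx; split.
    have := @hull_min _ (polygon_region P) _ (@halfplane_segconv _ (e1 0 (-1)) (e1 (- M) 0)).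
    suff h : polygon_region P `<=` [set y | 0 <= det2 (e1 0 (-1)) (y - e1 (- M) 0)].
      by move=> /(_ h x hx) /=; rewrite E1; lra.
    by apply: halfplane_region => j; rewrite /= E1; have := vM j; rewrite ler_norml => /andP[]; lra.
  have := @hull_min _ (polygon_region P) _ (@halfplane_segconv _ (e1 0 1) (e1 M 0)).
  suff h : polygon_region P `<=` [set y | 0 <= det2 (e1 0 1) (y - e1 M 0)].
    by move=> /(_ h x hx) /=; rewrite E2; lra.
  by apply: halfplane_region => j; rewrite /= E2; have := vM j; rewrite ler_norml => /andP[]; lra.
exists M => rho [rho0 [c0 hc0]].
(* Both ends of the horizontal diameter lie in the strip, so [rho <= M]. *)
have s1 : disc c0 rho (c0 + e1 rho 0).
  by rewrite /disc /= dist_le // !mxE /= le_eqVlt; apply/orP; left; apply/eqP; ring.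
have s2 : disc c0 rho (c0 - e1 rho 0).
  by rewrite /disc /= dist_le // !mxE /= le_eqVlt; apply/orP; left; apply/eqP; ring.
have := hull_strip _ (hc0 _ s1); have := hull_strip _ (hc0 _ s2).
by rewrite !mxE /= => -[? ?] [? ?]; lra.
Qed.

End Irch.

(** * The critical cubic *)

Section CriticalCubic.
Context {R : realType}.
Implicit Types r d x a b e : R.

Lemma critical_cubicE r d x :
  (critical_cubic r d).[x] = x ^+ 3 - r * x ^+ 2 + d ^+ 2 * x + d ^+ 2 * r.
Proof. by rewrite /critical_cubic !hornerE. Qed.

(** The cubic is positive at 0, and at [r / 2] it equals [(3 r / 2) (d^2 - r^2 / 12)], which the
    bound on [d] makes nonpositive. There [2 x = r]: the extremal triangle is equilateral, with
    inradius [sqrt 3 / 6 * r]. *)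
Lemma least_root_le_half r d x : 0 < r -> 0 < d -> d <= Num.sqrt 3%:R / 6%:R * r ->
  least [set x | 0 < x /\ root (critical_cubic r d) x] x -> x <= r / 2.
Proof.
move=> r0 d0 dr [_ xlb].
have d2 : d ^+ 2 <= r ^+ 2 / 12%:R.
  have -> : r ^+ 2 / 12%:R = (Num.sqrt 3%:R / 6%:R * r) ^+ 2.
    by rewrite !exprMn sqr_sqrtr ?ler0n //; field.
  by rewrite ler_sqr ?nnegrE ?(ltW d0) // (le_trans (ltW d0)).
have [y /andP[y0 y1] yr] : exists2 y, 0 <= y <= r / 2 & root (- critical_cubic r d) y.
  apply: poly_ivt; first by rewrite divr_ge0 // ltW.
  rewrite !hornerN !critical_cubicE; apply/andP; split.
    rewrite oppr_le0 expr0n /= expr0n /= !mulr0 subrr !add0r.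
    by rewrite mulr_ge0 ?sqr_ge0 // ltW.
  have -> : (r / 2) ^+ 3 - r * (r / 2) ^+ 2 + d ^+ 2 * (r / 2) + d ^+ 2 * r =
      r * (3%:R / 2%:R) * (d ^+ 2 - r ^+ 2 / 12%:R) by field.
  rewrite oppr_ge0; apply: mulr_ge0_le0; last by rewrite subr_le0.
  by rewrite mulr_ge0 ?divr_ge0 ?ler0n // ltW.
rewrite rootN in yr; apply: le_trans y1; apply: xlb; split => //=.
rewrite lt_neqAle y0 andbT; apply/eqP => y0'; move: yr.
rewrite -y0' rootE critical_cubicE expr0n /= expr0n /= !mulr0 subrr !add0r.
by rewrite mulf_eq0 sqrf_eq0 !gt_eqF.
Qed.

(* By Heron's formula the inradius [D / (a + b + e)] of a triangle with sides
   [a, b, e] is at most that of the isosceles triangle with legs [r] and base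
   [2 x], and the cubic says that the latter inradius is [d]. *)
Lemma inradius_ge_extremal r d x a b e D :
  0 < d -> 0 < x -> x <= r / 2 ->
  x ^+ 3 - r * x ^+ 2 + d ^+ 2 * x + d ^+ 2 * r = 0 ->
  0 <= a -> a <= r -> 0 <= b -> b <= r -> 0 <= e -> e <= 2%:R * x ->
  4%:R * D ^+ 2 = (a + b + e) * (a + b - e) * (a - b + e) * (b - a + e) ->
  0 < a + b + e -> d <= D / (a + b + e) ->
  [/\ a = r, b = r & e = 2%:R * x].
Proof.
move=> d0 x0 xr hx a0 ar b0 br e0 ex heron p0; rewrite ler_pdivlMr // => dD.
set p := a + b + e in p0 dD heron *.
have d2 : 0 < d ^+ 2 by rewrite exprn_gt0.
have dD2 : (d * p) ^+ 2 <= D ^+ 2.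
  have dp : 0 <= d * p by rewrite mulr_ge0 // ltW.
  by rewrite ler_sqr // nnegrE // (le_trans dp).
have H1 : 4%:R * d ^+ 2 * p <= (a + b - e) * (e ^+ 2 - (a - b) ^+ 2).
  rewrite -(ler_pM2l p0); have -> : p * ((a + b - e) * (e ^+ 2 - (a - b) ^+ 2)) =
    4%:R * D ^+ 2 by rewrite heron; ring.
  by rewrite exprMn in dD2; lra.
have H0 : 0 < 4%:R * d ^+ 2 * p by rewrite !mulr_gt0 // ltr0n.
have Se : e < a + b.
  rewrite ltNge; apply/negP => Se.
  suff : (a + b - e) * (e ^+ 2 - (a - b) ^+ 2) <= 0 by lra.
  by rewrite subr_sqr; apply: mulr_le0_ge0; [lra|apply: mulr_ge0; lra].
have H2 : 4%:R * d ^+ 2 * p <= (a + b - e) * e ^+ 2.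
  by apply: (le_trans H1); rewrite ler_pM2l; [have := sqr_ge0 (a - b); lra|lra].
pose y := e / 2%:R; have eE : e = 2%:R * y by rewrite /y; field.
have y0 : 0 <= y by rewrite /y divr_ge0.
have yx : y <= x by lra.
(* Heron's bound with [(a - b) ^+ 2] dropped, in terms of the half base [y]. *)
have H3 : 2%:R * y * (y ^+ 2 + d ^+ 2) <= (a + b) * (y ^+ 2 - d ^+ 2).
  by move: H2; rewrite /p eE; lra.
have S0 : 0 < a + b by lra.
have yp : 0 < y.
  rewrite lt_neqAle y0 andbT; apply/eqP => yE; move: H3; rewrite -yE.
  have : 0 < (a + b) * d ^+ 2 by rewrite mulr_gt0.
  lra.
have yd : 0 < y ^+ 2 - d ^+ 2.
  rewrite -(pmulr_rgt0 _ S0); apply: lt_le_trans H3.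
  have y2 : 0 < y ^+ 2 by rewrite exprn_gt0.
  by apply: mulr_gt0; lra.
have H4 : (a + b) * (y ^+ 2 - d ^+ 2) <= 2%:R * r * (y ^+ 2 - d ^+ 2).
  by rewrite ler_pM2r //; lra.
(* By [H3] and [H4] the cubic is at most 0 at [y], and it vanishes at [x]. If [y < x], its
   difference quotient is thus nonnegative; but [2 x <= r] and [d ^+ 2 < y ^+ 2] put it below
   [- (x - y) (x + 2 y)], which is negative. *)
have xy : y = x.
  apply/eqP; rewrite eq_le yx leNgt; apply/negP => xy.
  have : 0 <= (x - y) * (x ^+ 2 + x * y + y ^+ 2 - r * (x + y) + d ^+ 2) by lra.
  rewrite pmulr_rge0; last by lra.
  have : 2%:R * x * (x + y) <= r * (x + y) by rewrite ler_pM2r; lra.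
  have : 0 <= (x - y) * (x + 2%:R * y) by apply: mulr_ge0; lra.
  lra.
rewrite xy in H3 H4 yd eE.
have : 2%:R * r * (x ^+ 2 - d ^+ 2) <= (a + b) * (x ^+ 2 - d ^+ 2) by lra.
by rewrite ler_pM2r // => S; split; lra.
Qed.

End CriticalCubic.

(** * Caratheodory reductions and distances of convex combinations *)

Section Caratheodory.
Context {R : realType}.
Implicit Types (a b c d x z : plane R).

Lemma segment_comb a b (s t : R) : 0 <= s -> 0 <= t -> s + t = 1 ->
  segment a b (s *: a + t *: b).
Proof.
move=> s0 t0 h; exists t; first by apply/andP; split; lra.
by rewrite /between (_ : 1 - t = s) //; lra.
Qed.

(** The ratio test: the least [w j / k j] over positive [k j] is the largest multiple of [k] that
    can be subtracted with all weights remaining nonnegative. *)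
Lemma vanishing_coefficient n (w k : 'I_n -> R) i0 :
  (forall i, 0 <= w i) -> 0 < k i0 ->
  exists l i, [/\ 0 <= l, forall j, 0 <= w j - l * k j, 0 < k i & w i = l * k i].
Proof.
move=> w0 k0; pose i := [arg min_(j < i0 | 0 < k j) w j / k j]%O.
have [ki imin] : 0 < k i /\ forall j, 0 < k j -> w i / k i <= w j / k j.
  by rewrite /i; case: arg_minP.
exists (w i / k i), i; split => //; first by rewrite divr_ge0 // ltW.
  move=> j; have [kj|kj] := ltP 0 (k j).
    by rewrite subr_ge0 -ler_pdivlMr //; exact: imin.
  rewrite subr_ge0; apply: le_trans (w0 j); apply: mulr_ge0_le0 => //.
  by rewrite divr_ge0 // ltW.
by rewrite divfK // gt_eqF.
Qed.

Lemma vanishing_coefficient3 (w1 w2 w3 k1 k2 k3 : R) :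
  0 <= w1 -> 0 <= w2 -> 0 <= w3 -> [\/ 0 < k1, 0 < k2 | 0 < k3] ->
  exists l, [/\ 0 <= l, 0 <= w1 - l * k1, 0 <= w2 - l * k2, 0 <= w3 - l * k3 &
    [\/ 0 < k1 /\ w1 = l * k1, 0 < k2 /\ w2 = l * k2 | 0 < k3 /\ w3 = l * k3]].
Proof.
move=> h1 h2 h3 hk.
pose w (i : 'I_3) := nth 0 [:: w1; w2; w3] i; pose k (i : 'I_3) := nth 0 [:: k1; k2; k3] i.
have [i0 ki0] : exists i0, 0 < k i0.
  by case: hk => h; [exists 0|exists 1|exists 2%:R].
have w0 i : 0 <= w i by case: i => -[|[|[|//]]].
have [l [i [l0 hl ki wi]]] := vanishing_coefficient w0 ki0.
exists l; split => //; [exact: (hl 0)|exact: (hl 1)|exact: (hl 2%:R)|].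
case: i ki wi => -[|[|[|//]]] hi; rewrite /w /k /= => ? ?;
  [exact: Or31|exact: Or32|exact: Or33].
Qed.

(** Weight on [x], [a], [b] is traded for weight on [d] until one of the three vanishes. The
    recorded positivity discards the piece that degenerates when [d] lies on a side. *)
Lemma tri_split x a b d z (xi al be : R) : 0 <= xi -> 0 <= al -> 0 <= be ->
  xi + al + be = 1 -> d = xi *: x + al *: a + be *: b -> tri x a b z ->
  [\/ 0 < be /\ tri x a d z, 0 < al /\ tri x d b z | 0 < xi /\ tri a d b z].
Proof.
move=> xi0 al0 be0 h dE [s [t [q [s0 t0 q0 h' zE]]]].
have hk : [\/ 0 < xi, 0 < al | 0 < be].
  have [?|?] := ltP 0 xi; first exact: Or31.
  by have [?|?] := ltP 0 al; [exact: Or32|apply: Or33; lra].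
have [l [l0 hs ht hq hz]] := vanishing_coefficient3 s0 t0 q0 hk.
have lsum : l * xi + l * al + l * be = l by rewrite -!mulrDr h mulr1.
case: hz => -[k0 kE]; [apply: Or33|apply: Or32|apply: Or31]; split => //.
- exists (t - l * al), l, (q - l * be); split=> //; first by lra.
  by rewrite zE dE kE; apply: plane_eq; rewrite !mxE; ring.
- exists (s - l * xi), l, (q - l * be); split=> //; first by lra.
  by rewrite zE dE kE; apply: plane_eq; rewrite !mxE; ring.
- exists (s - l * xi), (t - l * al), l; split=> //; first by lra.
  by rewrite zE dE kE; apply: plane_eq; rewrite !mxE; ring.
Qed.

(** Collinear points satisfy a nontrivial affine relation, with coefficients [xi], [al], [be] of sum
    0; subtracting a multiple of it removes one vertex. *)
Lemma degenerate_tri x a b z : area2 x a b = 0 -> tri x a b z ->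
  [\/ segment x a z, segment x b z | segment a b z].
Proof.
move=> D0 [s [t [q [s0 t0 q0 h zE]]]].
have [[al be] [nz hx hy]] : exists k : R * R, [/\ ~~ ((k.1 == 0) && (k.2 == 0)),
    k.1 * (a 0 0 - x 0 0) + k.2 * (b 0 0 - x 0 0) = 0 &
    k.1 * (a 0 1 - x 0 1) + k.2 * (b 0 1 - x 0 1) = 0].
  move: D0; rewrite /area2 /det2 !mxE => D0.
  have [n0|n0] := boolP ((b 0 0 - x 0 0 == 0) && (a 0 0 - x 0 0 == 0)).
    have [n1|n1] := boolP ((b 0 1 - x 0 1 == 0) && (a 0 1 - x 0 1 == 0)).
      exists (1, 1); rewrite /= oner_eq0; split=> //.
        by move: n0 => /andP[/eqP -> /eqP ->]; rewrite !mulr0 addr0.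
      by move: n1 => /andP[/eqP -> /eqP ->]; rewrite !mulr0 addr0.
    exists (b 0 1 - x 0 1, - (a 0 1 - x 0 1)); rewrite /= oppr_eq0; split=> //; lra.
  exists (b 0 0 - x 0 0, - (a 0 0 - x 0 0)); rewrite /= oppr_eq0; split=> //; lra.
rewrite /= in nz hx hy; pose xi := - al - be.
have hk : [\/ 0 < xi, 0 < al | 0 < be].
  have [?|al0] := ltP 0 al; first exact: Or32.
  have [?|be0] := ltP 0 be; first exact: Or33.
  apply: Or31; rewrite /xi lt_neqAle; apply/andP; split; last by lra.
  by apply: contra nz => /eqP e; apply/andP; split; apply/eqP; lra.
have [l [l0 hs ht hq hz]] := vanishing_coefficient3 s0 t0 q0 hk.
have zE' : z = (s - l * xi) *: x + (t - l * al) *: a + (q - l * be) *: b.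
  have lx := congr1 ( *%R l) hx; have ly := congr1 ( *%R l) hy.
  by rewrite zE /xi; apply: plane_eq; rewrite !mxE; [move: lx|move: ly]; rewrite mulr0; lra.
have sum1 : (s - l * xi) + (t - l * al) + (q - l * be) = 1 by rewrite /xi; lra.
case: hz => -[_ kE].
- apply: Or33; move: sum1; rewrite zE' kE subrr scale0r !add0r; exact: segment_comb.
- apply: Or32; move: sum1; rewrite zE' kE subrr scale0r !addr0; exact: segment_comb.
- apply: Or31; move: sum1; rewrite zE' kE subrr scale0r !addr0; exact: segment_comb.
Qed.

(** [z] is a combination of [x], [a], [b], [c]. Expressing [x] through [a], [b], [c] gives a
    relation that removes one corner, while the weight of [x] only grows. *)
Lemma tri_cover a b c x y z : area2 a b c != 0 -> tri a b c y -> segment y x z ->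
  [\/ tri x a b z, tri x b c z | tri x c a z].
Proof.
move=> D0 [s [t [q [s0 t0 q0 h yE]]]] [m /= /andP[m0 m1] zE].
have xE := baryE x D0; have bsum := bary_sum x D0.
set k1 := bary a b c x in xE bsum; set k2 := bary b c a x in xE bsum.
set k3 := bary c a b x in xE bsum.
have hk : [\/ 0 < k1, 0 < k2 | 0 < k3].
  have [?|?] := ltP 0 k1; first exact: Or31.
  by have [?|?] := ltP 0 k2; [exact: Or32|apply: Or33; lra].
have w0 (v : R) : 0 <= v -> 0 <= (1 - m) * v by move=> v0; apply: mulr_ge0; lra.
have [l [l0 hs ht hq hz]] := vanishing_coefficient3 (w0 _ s0) (w0 _ t0) (w0 _ q0) hk.
have lsum : l * k1 + l * k2 + l * k3 = l by rewrite -!mulrDr bsum mulr1.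
have wsum : (1 - m) * s + (1 - m) * t + (1 - m) * q = 1 - m by rewrite -!mulrDr h mulr1.
have zE' : z = (m + l) *: x + ((1 - m) * s - l * k1) *: a +
    ((1 - m) * t - l * k2) *: b + ((1 - m) * q - l * k3) *: c.
  have lx : l *: x = (l * k1) *: a + (l * k2) *: b + (l * k3) *: c.
    by rewrite {1}xE !scalerDr !scalerA.
  rewrite (scalerDl x m l) lx -zE yE.
  by apply: plane_eq; rewrite betweenE !mxE; ring.
have ml : 0 <= m + l by rewrite addr_ge0.
case: hz => -[_ kE]; [apply: Or32|apply: Or33|apply: Or31].
- exists (m + l), ((1 - m) * t - l * k2), ((1 - m) * q - l * k3); split => //; first by lra.
  by rewrite zE' kE subrr scale0r addr0.
- exists (m + l), ((1 - m) * q - l * k3), ((1 - m) * s - l * k1); split => //; first by lra.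
  by rewrite zE' kE subrr scale0r addr0 -!addrA [X in _ + X]addrC.
- exists (m + l), ((1 - m) * s - l * k1), ((1 - m) * t - l * k2); split => //; first by lra.
  by rewrite zE' kE subrr scale0r addr0.
Qed.

Lemma dist_comb x a b p (xi al be r : R) : p = xi *: x + al *: a + be *: b ->
  xi + al + be = 1 -> 0 <= al -> 0 <= be -> dist x a <= r -> dist x b <= r ->
  dist x p <= (al + be) * r.
Proof.
move=> pE h al0 be0 xa xb; have r0 : 0 <= r := le_trans (dist_ge0 _ _) xa.
rewrite dist_le // in xa; rewrite dist_le // in xb.
rewrite dist_le ?mulr_ge0 ?addr_ge0 // pE !mxE; have {h} -> : xi = 1 - al - be by lra.
set A := x 0 0 - a 0 0 in xa; set B := x 0 1 - a 0 1 in xa.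
set A' := x 0 0 - b 0 0 in xb; set B' := x 0 1 - b 0 1 in xb.
have -> : x 0 0 - ((1 - al - be) * x 0 0 + al * a 0 0 + be * b 0 0) = al * A + be * A'.
  by rewrite /A /A'; ring.
have -> : x 0 1 - ((1 - al - be) * x 0 1 + al * a 0 1 + be * b 0 1) = al * B + be * B'.
  by rewrite /B /B'; ring.
(* The sum of [h1], [h2] and [h3] is exactly the difference between the two sides of the goal. *)
have h1 : 0 <= al * (al + be) * (r ^+ 2 - (A ^+ 2 + B ^+ 2)).
  by apply: mulr_ge0; [apply: mulr_ge0 => //; exact: addr_ge0|rewrite subr_ge0].
have h2 : 0 <= be * (al + be) * (r ^+ 2 - (A' ^+ 2 + B' ^+ 2)).
  by apply: mulr_ge0; [apply: mulr_ge0 => //; exact: addr_ge0|rewrite subr_ge0].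
have h3 : 0 <= al * be * ((A - A') ^+ 2 + (B - B') ^+ 2).
  by apply: mulr_ge0; [exact: mulr_ge0|apply: addr_ge0; exact: sqr_ge0].
lra.
Qed.

Lemma disc_segconv x (r : R) : segconv (disc x r).
Proof.
move=> a b xa xb _ [t /= /andP[t0 t1] <-].
have -> : r = (1 - t + t) * r by rewrite subrK mul1r.
apply: (dist_comb (xi := 0) (a := a) (b := b)); rewrite // ?subr_ge0 //.
  by rewrite scale0r add0r.
by rewrite add0r subrK.
Qed.

Lemma dist_segment a b p : segment a b p -> dist a p <= dist a b.
Proof.
move=> [t /= /andP[t0 t1] <-]; apply: le_trans (_ : (t + 0) * dist a b <= _).
  apply: (dist_comb (xi := 1 - t) (a := b) (b := b)); rewrite ?scale0r ?addr0 //.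
  by rewrite subrK.
by rewrite addr0 ler_piMl ?dist_ge0.
Qed.

End Caratheodory.

(** * Triangles with sides in the layout *)

Section Barrier.
Context {R : realType} {b : nat}.
Variable L : layout R b.
Implicit Types (A B D X Z : plane R).

Lemma sub_tri_bounded (S : set (plane R)) A B D : S `<=` tri A B D -> bounded_set S.
Proof.
move=> hS; pose m := `|A| + `|B| + `|D| + 1.
have hm Z : `|Z| < m -> ball (0 : plane R) m Z.
  by rewrite -ball_normE /ball_ /= sub0r normrN.
have A0 := normr_ge0 A; have B0 := normr_ge0 B; have D0 := normr_ge0 D.
have htri : tri A B D `<=` ball 0 m.
  by apply: tri_min; [exact: ball_segconv|apply: hm; rewrite /m; lra..].
exists m; split; first exact: num_real.
move=> m' mm' Z /hS /htri; rewrite -ball_normE /ball_ /= sub0r normrN => h.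
by apply: ltW; apply: lt_trans mm'.
Qed.

Lemma blocked_triangle X A B Z :
  segment X A `<=` layout_set L -> segment X B `<=` layout_set L ->
  segment A B `<=` layout_set L -> tri X A B Z -> ~ layout_set L Z ->
  area2 X A B != 0 /\ exists i, irch (obstacle L i) <=
    `|area2 X A B| / (dist B X + dist A B + dist X A).
Proof.
move=> XA XB AB hZ nZ.
have D0 : area2 X A B != 0.
  by apply/eqP => D0; case: (degenerate_tri D0 hZ) => [/XA|/XB|/AB].
split=> //.
(* A component outside the layout cannot cross the sides of the triangle, which lie in the
   layout. *)
have trap G : ~ G Z -> (forall W, connected_component (~` G) Z W -> ~ layout_set L W) ->
    connected_component (~` G) Z `<=` tri X A B.
  move=> GZ hC; apply: connected_sub_tri => //; first exact: component_connected.
  - by exists Z; split=> //; exact: connected_component_refl.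
  - by move=> W /hC nW /XA.
  - by move=> W /hC nW /AB.
  - by move=> W /hC nW; rewrite segmentC => /XB.
have [wZ|nwZ] := pselect (polygon_region (walls L) Z).
  have [i _ [Zb bZ]] : (\bigcup_i polygon_inside (obstacle L i)) Z.
    by apply: contrapT => h; apply: nZ.
  exists i; apply: irch_le_tri => //.
  have CT : connected_component (~` polygon_boundary (obstacle L i)) Z `<=` tri X A B.
    apply: trap => // W CW [_ nW]; apply: nW; exists i => //; split.
      exact: connected_component_sub CW.
    by rewrite -(same_connected_component CW).
  apply: subset_trans (boundary_sub_closure_component Zb) _.
  by apply: subset_trans (closureS CT) _; rewrite -(closure_id _).1 //; exact: tri_closed.
(* Here [Z] lies beyond the walls; being trapped, its component would be bounded, which puts [Z]
   inside them. *)
exfalso; have nGZ : ~ polygon_boundary (walls L) Z by move=> h; apply: nwZ; right.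
apply: nwZ; left; split=> //; have [//|nbd] := pselect (bounded_set
  (connected_component (~` polygon_boundary (walls L)) Z)).
apply: (@sub_tri_bounded _ X A B); apply: trap => // W CW [[[_ bW]|GW] _].
  by apply: nbd; rewrite (same_connected_component CW).
exact: (connected_component_sub CW).
Qed.

End Barrier.

(** * The extremal blocked triangle and its exclusion *)

Section Blocking.
Context {R : realType} {b : nat}.
Variables (r d xs : R) (L : layout R b).
Hypotheses (r0 : 0 < r) (d0 : 0 < d) (xs0 : 0 < xs) (xsr : xs <= r / 2).
Hypothesis xs_root : xs ^+ 3 - r * xs ^+ 2 + d ^+ 2 * xs + d ^+ 2 * r = 0.
Hypothesis d_le : forall i, d <= irch (obstacle L i).
Implicit Types (A B D W X Z : plane R).

(** [d] is at most the IRCH of the trapped obstacle, which is at most the inradius of [X A B], so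
    [inradius_ge_extremal] applies. Hence a blocked triangle with a leg shorter than [r] is
    absurd. *)
Lemma blocked_triangle_extremal X A B Z :
  segment X A `<=` layout_set L -> segment X B `<=` layout_set L ->
  segment A B `<=` layout_set L ->
  dist X A <= r -> dist X B <= r -> dist A B <= 2%:R * xs ->
  tri X A B Z -> ~ layout_set L Z ->
  [/\ area2 X A B != 0, dist X A = r & dist X B = r].
Proof.
move=> XA XB AB rA rB eAB hZ nZ.
have [D0 [i hi]] := blocked_triangle XA XB AB hZ nZ.
have := le_trans (d_le i) hi; have := perimeter_gt0 D0; have := heron X A B.
set s := dist B X + dist A B + dist X A.
have -> : s = dist X A + dist X B + dist A B by rewrite /s (distC B X); ring.
rewrite /= (distC B X) => hh p0 hd.
rewrite -(real_normK (num_real (area2 X A B))) in hh.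
have [|-> -> _] // := inradius_ge_extremal d0 xs0 xsr xs_root (dist_ge0 _ _) rA
  (dist_ge0 _ _) rB (dist_ge0 _ _) eAB _ p0 hd.
by rewrite hh; ring.
Qed.

Section ThirdVertex.
Variables (X Z : plane R).
Hypothesis nZ : ~ layout_set L Z.

(* The edge [A D] crosses [X B], and the smaller triangle cut off at [X] has
   a side of length [< r]; or [B] is swallowed by the triangle [X A D]. *)
Lemma third_vertex_beyond A B D (xi al be : R) :
  tri A B D `<=` layout_set L -> segment X A `<=` layout_set L ->
  segment X B `<=` layout_set L -> segment X D `<=` layout_set L ->
  dist X A <= r -> dist X D <= r -> dist A D <= 2%:R * xs ->
  dist X B = r -> tri X A B Z ->
  D = xi *: X + al *: A + be *: B -> xi + al + be = 1 ->
  al < 0 -> 0 <= be -> xi != 0 -> False.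
Proof.
move=> hp XA XB XD rA rD eAD rB hZ DE h al0 be0 xin0.
have [xi0|] := ltP 0 xi; last first.
  rewrite le_eqVlt (negbTE xin0) /= => xi0.
  (* Solved for [B], the relation puts [B] in the triangle [X A D] with positive weight on [X], so
     [dist X B < r]. *)
  have bep : 0 < be by lra.
  have BE : B = (- xi / be) *: X + be^-1 *: D + (- al / be) *: A.
    by rewrite DE; apply: plane_eq; rewrite !mxE; field; lra.
  have := dist_comb BE _ _ _ rD rA; rewrite rB.
  have s1 : - xi / be + be^-1 + - al / be = 1.
    by have -> : al = 1 - xi - be by [lra]; field; lra.
  have i0 : 0 <= be^-1 by rewrite invr_ge0.
  have j0 : 0 <= - al / be by rewrite divr_ge0 // oppr_ge0 ltW.
  move=> /(_ s1 i0 j0); rewrite -[X in X <= _]mul1r ler_pM2r //.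
  have : 0 < - xi / be by rewrite divr_gt0 // oppr_gt0.
  lra.
have m0 : 0 < 1 - al by lra.
(* The parameter that cancels the weight of [A]: [W] is where [A D] meets [X B]. *)
pose W := between A D (1 - al)^-1.
have WAD : segment A D W.
  exists (1 - al)^-1 => //=; rewrite invr_ge0 (ltW m0) /= invf_le1 //; lra.
have t0 : 0 <= xi / (1 - al) by rewrite divr_ge0 // ltW.
have u0 : 0 <= be / (1 - al) by rewrite divr_ge0 // ltW.
have sum1 : xi / (1 - al) + 0 + be / (1 - al) = 1.
  by have -> : xi = 1 - al - be by [lra]; field; lra.
have WE : W = (xi / (1 - al)) *: X + 0 *: A + (be / (1 - al)) *: B.
  by rewrite /W DE; apply: plane_eq; rewrite betweenE !mxE; field; lra.
have hpAD : segment A D `<=` tri A B D.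
  by apply: tri_segconv; [exact: tri1|exact: tri3].
have WXB : segment X B W.
  by rewrite WE scale0r addr0; apply: segment_comb; lra.
(* [W] cuts [X A B] into [X A W], which has a leg shorter than [r], and [A W B], which is part of
   [A B D]. *)
case: (tri_split t0 (lexx 0) u0 sum1 WE hZ) => [[_ XAW]|[]|[_ AWB]].
- have XW : segment X W `<=` layout_set L.
    by apply: subset_trans XB; apply: segment_segconv => //; exact: segmentL.
  have AW : segment A W `<=` layout_set L.
    apply: subset_trans hp; apply: subset_trans hpAD.
    by apply: segment_segconv => //; exact: segmentL.
  have rW : dist X W <= be / (1 - al) * r.
    have := dist_comb WE sum1 (lexx 0) u0 rA; rewrite add0r; apply.
    by rewrite rB.
  have be1 : be / (1 - al) < 1.
    have : 0 < xi / (1 - al) by rewrite divr_gt0.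
    lra.
  have rWr : dist X W < r by apply: le_lt_trans rW _; rewrite gtr_pMl.
  have eAW : dist A W <= 2%:R * xs by apply: le_trans (dist_segment WAD) eAD.
  have [_ _ rWE] := blocked_triangle_extremal XA XW AW rA (ltW rWr) eAW XAW nZ.
  by rewrite rWE ltxx in rWr.
- by rewrite ltxx.
- apply: nZ; apply: hp; apply: (tri_min _ _ _ _ AWB).
  + exact: tri_segconv.
  + exact: tri1.
  + exact: hpAD.
  + exact: tri2.
Qed.

(** The cases are the signs of the barycentric coordinates of [D] in [X A B]. Unless [B] or [A] is
    swallowed as in [third_vertex_beyond], each puts [Z] in the triangle [A B D] or in a blocked
    triangle with a leg shorter than [r]. *)
Lemma no_blocked_triangle A B D : area2 A B D != 0 ->
  tri A B D `<=` layout_set L ->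
  segment X A `<=` layout_set L -> segment X B `<=` layout_set L ->
  segment X D `<=` layout_set L ->
  dist X A <= r -> dist X B <= r -> dist X D <= r ->
  dist A B <= 2%:R * xs -> dist B D <= 2%:R * xs -> dist A D <= 2%:R * xs ->
  tri X A B Z -> False.
Proof.
move=> DD hp XA XB XD rA rB rD eAB eBD eAD hZ.
have pc := @tri_segconv R A B D.
have pA := tri1 A B D; have pB := tri2 A B D; have pD := tri3 A B D.
have AB : segment A B `<=` layout_set L by apply: subset_trans hp; exact: pc.
have [D0 rAE rBE] := blocked_triangle_extremal XA XB AB rA rB eAB hZ nZ.
have DE := baryE D D0; have h := bary_sum D D0.
set xi := bary X A B D in DE h; set al := bary A B X D in DE h.
set be := bary B X A D in DE h.
have xin0 : xi != 0.
  apply: contra DD => /eqP xi0.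
  have -> : area2 A B D = xi * area2 X A B.
    by rewrite /xi /bary divfK // /area2 /det2 !mxE; ring.
  by rewrite xi0 mul0r.
have [al0|al0] := ltP al 0; have [be0|be0] := ltP be 0.
(* Solved for [X], the relation puts [X], and with it all of [X A B], in the triangle [A B D]. *)
- have xip : 0 < xi by lra.
  apply: nZ; apply: hp; apply: (tri_min pc _ pA pB hZ).
  exists (- al / xi), (- be / xi), xi^-1; split.
  + by rewrite divr_ge0 ?oppr_ge0 // ltW.
  + by rewrite divr_ge0 ?oppr_ge0 // ltW.
  + by rewrite invr_ge0 ltW.
  + by have -> : al = 1 - xi - be by [lra]; field; lra.
  + by rewrite DE; apply: plane_eq; rewrite !mxE; field; lra.
- exact: (third_vertex_beyond hp XA XB XD rA rD eAD rBE hZ DE h al0 be0).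
- have hp' : tri B A D `<=` layout_set L.
    by apply: subset_trans hp; apply: tri_min.
  have hZ' : tri X B A Z.
    by move: hZ; apply: tri_min; [exact: tri_segconv|exact: tri1|exact: tri3|exact: tri2].
  apply: (third_vertex_beyond hp' XB XA XD rB rD eBD rAE hZ' _ _ be0 al0 xin0).
    by rewrite {1}DE addrAC.
  by rewrite addrAC.
(* With [xi] positive, [D] lies in [X A B] and is closer to [X] than [r]; it splits the triangle. *)
have [xi0|xi0] := ltP 0 xi.
  have rD' : dist X D < r.
    apply: (le_lt_trans (dist_comb DE h al0 be0 rA rB)).
    by rewrite gtr_pMl //; lra.
  have AD : segment A D `<=` layout_set L by apply: subset_trans hp; exact: pc.
  have DB : segment D B `<=` layout_set L by apply: subset_trans hp; exact: pc.
  case: (tri_split (ltW xi0) al0 be0 h DE hZ) => -[_].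
  + move=> hZ'; have [_ _ rDE] := blocked_triangle_extremal XA XD AD rA rD eAD hZ' nZ.
    by rewrite rDE ltxx in rD'.
  + move=> hZ'; rewrite distC in eBD.
    have [_ rDE _] := blocked_triangle_extremal XD XB DB rD rB eBD hZ' nZ.
    by rewrite rDE ltxx in rD'.
  + by move=> hZ'; apply: nZ; apply: hp; apply: (tri_min pc _ _ _ hZ').
have {}xi0 : xi < 0 by rewrite lt_neqAle xin0.
have m0 : 0 < 1 - xi by lra.
(* [D] lies beyond [A B] as seen from [X]; [W] is where [X D] crosses [A B], and it is closer to [X]
   than [r]. *)
pose W := between X D (1 - xi)^-1.
have WXD : segment X D W.
  exists (1 - xi)^-1 => //=; rewrite invr_ge0 (ltW m0) /= invf_le1 //; lra.
have t0 : 0 <= al / (1 - xi) by rewrite divr_ge0 // ltW.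
have u0 : 0 <= be / (1 - xi) by rewrite divr_ge0 // ltW.
have sum1 : 0 + al / (1 - xi) + be / (1 - xi) = 1.
  by have -> : al = 1 - xi - be by [lra]; field; lra.
have WE : W = 0 *: X + (al / (1 - xi)) *: A + (be / (1 - xi)) *: B.
  by rewrite /W {1}DE; apply: plane_eq; rewrite betweenE !mxE; field; lra.
have WAB : segment A B W by rewrite WE scale0r add0r; apply: segment_comb; lra.
have XW : segment X W `<=` layout_set L.
  by apply: subset_trans XD; apply: segment_segconv => //; exact: segmentL.
have AW : segment A W `<=` layout_set L.
  by apply: subset_trans AB; apply: segment_segconv => //; exact: segmentL.
have WB : segment W B `<=` layout_set L.
  by apply: subset_trans AB; apply: segment_segconv => //; exact: segmentR.
have rW : dist X W < r.
  apply: (@le_lt_trans _ _ ((1 - xi)^-1 * r)); last first.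
    by rewrite gtr_pMl // invf_lt1 //; lra.
  have WE' : W = (1 - (1 - xi)^-1) *: X + (1 - xi)^-1 *: D + 0 *: D.
    by rewrite /W /between scale0r addr0.
  rewrite -[(1 - xi)^-1]addr0; apply: (dist_comb WE') => //.
    by rewrite addr0 subrK.
  by rewrite invr_ge0 ltW.
have eAW : dist A W <= 2%:R * xs by apply: le_trans (dist_segment WAB) eAB.
have eWB : dist W B <= 2%:R * xs.
  apply: le_trans eAB; rewrite distC (distC A B); apply: dist_segment.
  by rewrite segmentC.
case: (tri_split (lexx 0) t0 u0 sum1 WE hZ) => [[_ hZ']|[_ hZ']|[]].
- have [_ _ rWE] := blocked_triangle_extremal XA XW AW rA (ltW rW) eAW hZ' nZ.
  by rewrite rWE ltxx in rW.
- have [_ rWE _] := blocked_triangle_extremal XW XB WB (ltW rW) rB eWB hZ' nZ.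
  by rewrite rWE ltxx in rW.
- by rewrite ltxx.
Qed.

End ThirdVertex.
End Blocking.

(** * What the subdivision process preserves *)

Section Subdivision.
Context {R : realType} {b : nat}.
Implicit Types (t : triangle R) (L : layout R b).

Lemma ord3_cyclic : (ordS 0 = 1 :> 'I_3) * (ordS 1 = 2%:R :> 'I_3) *
  (ordS 2%:R = 0 :> 'I_3) * (ord_pred 0 = 2%:R :> 'I_3) *
  (ord_pred 1 = 0 :> 'I_3) * (ord_pred 2%:R = 1 :> 'I_3).
Proof. by do !split; exact: val_inj. Qed.

Definition nondegenerate t := area2 (t 0) (t 1) (t 2%:R) != 0.

Lemma collinear_area2 (x y z : plane R) : collinear x y z <-> area2 x y z = 0.
Proof. by rewrite /collinear /area2 /det2 !mxE; split=> h; lra. Qed.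

Lemma half_sub t i t' : halves t i t' -> triangle_set t' `<=` triangle_set t.
Proof.
have tv j : triangle_set t (t j) by apply: sub_hull; exists j.
have tm : triangle_set t (between (t (ordS i)) (t (ord_pred i)) 2^-1).
  apply: (@hull_segconv R (range t) _ _ (tv (ordS i)) (tv (ord_pred i))).
  by exists 2^-1 => //=; rewrite invr_ge0 ler0n invf_le1 ?ler1n ?ltr0n.
by case=> ->; apply: hull_min => [|_ [k _ <-]]; first [exact: hull_segconv |
  rewrite /replace_corner; case: ifP => _ //; exact: tv].
Qed.

(** Replacing an end of a side by its midpoint halves the signed area. *)
Lemma half_nondegenerate t i t' : nondegenerate t -> halves t i t' -> nondegenerate t'.
Proof.
rewrite /nondegenerate => t0.
suff h (s : R) : s != 0 -> area2 (t' 0) (t' 1) (t' 2%:R) = s * area2 (t 0) (t 1) (t 2%:R) ->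
    area2 (t' 0) (t' 1) (t' 2%:R) != 0.
  have s0 : 2^-1 != 0 :> R by rewrite invr_eq0 pnatr_eq0.
  by case=> t'E; apply: (h _ s0); rewrite t'E /replace_corner;
    case: (ord3P i) => ->; rewrite !ord3_cyclic /= /area2 /det2 !mxE; field.
by move=> s0 ->; rewrite mulf_neq0.
Qed.

Lemma subdivision_invariant ell L T : subdivision ell L T ->
  forall t, T t -> nondegenerate t /\ triangle_set t `<=` layout_set L.
Proof.
elim=> {T} [T tT t Tt|T t i _ IH _ Tt _ t' [[Tt' _]|ht']]; last 2 first.
- exact: IH.
- have [t0 tL] := IH _ Tt; split; first exact: half_nondegenerate ht'.
  exact: subset_trans (half_sub ht') tL.
split.
  by apply/eqP => /collinear_area2; exact: (triangulation_nondegenerate tT).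
by rewrite -(triangulation_cover tT) => x tx; exists t.
Qed.

End Subdivision.

Theorem lemma4 (R : realType) (r : R) (hr : 0 < r)
  (b : nat) (hb : (1 <= b)%N) (L : layout R b)
  (dmin : R) (hdmin : least (range (fun i : 'I_b => irch (obstacle L i))) dmin)
  (hdr : dmin <= Num.sqrt 3%:R / 6%:R * r)
  (xs : R) (hxs : least [set x | 0 < x /\ root (critical_cubic r dmin) x] xs)
  (ell : R) (hell : ell <= 2%:R * xs)
  (T : set (triangle R)) (hT : hyper_triangulation ell L T)
  (p : triangle R) (hp : T p) (X : plane R) :
  triangle_visibility r L p X ->
  forall Q : plane R, triangle_set p Q -> visibility r L Q X.
Proof.
move=> visX Q pQ.
have [[[i0 _ dE] dlb] [subT sideT]] := (hdmin, hT).
have d0 : 0 < dmin by rewrite -dE; exact: irch_gt0.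
have d_le i : dmin <= irch (obstacle L i) by apply: dlb; exists i.
have xsr := least_root_le_half hr d0 hdr hxs.
have [[xs0 /eqP xs_root] _] := hxs; rewrite critical_cubicE in xs_root.
have [nd] := subdivision_invariant subT hp; rewrite triangle_setE in pQ *.
set A := p 0 in pQ *; set B := p 1 in pQ *; set D := p 2%:R in pQ * => pL.
have see i : segment X (p i) `<=` layout_set L /\ dist X (p i) <= r.
  by have [? ?] := visX i I; rewrite segmentC distC.
have side i : dist (p (ordS i)) (p (ord_pred i)) <= 2%:R * xs.
  exact: le_trans (sideT p i hp) hell.
have [XA rA] := see 0; have [XB rB] := see 1; have [XD rD] := see 2%:R.
have eBD := side 0; have eDA := side 1; have eAB := side 2%:R.
rewrite !ord3_cyclic -/A -/B -/D in XA XB XD rA rB rD eBD eDA eAB.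
split; last first.
  rewrite distC; apply: (tri_min (disc_segconv (r := r)) rA rB rD pQ).
move=> Z QXZ; apply: contrapT => nZ.
have none := no_blocked_triangle hr d0 xs0 xsr xs_root d_le nZ.
have D1 : area2 B D A != 0 by rewrite area2C.
have D2 : area2 D A B != 0 by rewrite -area2C.
have p1 : tri B D A `<=` layout_set L by apply: subset_trans pL => x /tri_rot/tri_rot.
have p2 : tri D A B `<=` layout_set L by apply: subset_trans pL => x /tri_rot.
have sym (x y : plane R) : dist x y <= 2%:R * xs -> dist y x <= 2%:R * xs.
  by rewrite distC.
(* [Z] lies in the triangle spanned by [X] and some side of [p]; the three cases differ by a
   rotation of the corners. *)
case: (tri_cover nd pQ QXZ) => hZ.
- by apply: (none X A B D) hZ => //; exact: sym.
- by apply: (none X B D A) hZ => //; exact: sym.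
- by apply: (none X D A B) hZ => //; exact: sym.
Qed.
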